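(* Every countable $\mathrm{Con}_{\mathrm{sat}}$-saturated structure $M$ in a recursive language is transcendent.
   Context: All languages are countable and recursive; formulas are identified with their Gödel numbers, so a set of formulas (a theory, a type) can be an element of a subset of $\mathcal P(\omega)$. A ''type'' $p(\bar x)$ means any set of first-order formulas whose free variables are among the finite tuple $\bar x$ (not necessarily consistent). For such $p$, $p{\uparrow}$ denotes the $\mathcal L_{\omega_1\omega}$-sentence $\forall\bar x\bigvee_{\psi\in p}\neg\psi(\bar x)$ (''$p$ is omitted''). Consistency means semantic consistency (having a model). For a first-order theory $T_0$ in a language $\mathcal L$ and a (possibly non-first-order) theory $S$ in an extension $\mathcal L^+\supseteq\mathcal L$, $\mathrm{Con}_{\mathrm{sat}}(S/T_0)$ means: there is a model $N\models T_0+S$ whose $\mathcal L$-reduct is $\omega$-saturated. A Scott set is a nonempty $\mathcal X\subseteq\mathcal P(\omega)$ closed under finite unions, complements and Turing reducibility, such that every theory (in a recursive language) in $\mathcal X$ has a complete consistent extension in $\mathcal X$. A structure $M$ is $\mathcal X$-saturated if for every complete type $p(\bar x,\bar a)$ over $M$ with finitely many parameters $\bar a\in M$: $p(\bar x,\bar a)$ is realized in $M$ iff $p(\bar x,\bar y)\in\mathcal X$. A Scott set $\mathcal X$ is $\mathrm{Con}_{\mathrm{sat}}$-closed if for every recursive language $\mathcal L$, recursive extension $\mathcal L^+$, $\mathcal L$-theory $T_0\in\mathcal X$, $\mathcal L^+$-theory $T\in\mathcal X$ and $\mathcal L^+$-type $p(\bar x)\in\mathcal X$ with $\mathrm{Con}_{\mathrm{sat}}(T+p{\uparrow}/T_0)$,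 there is a complete $\mathcal L^+$-theory $T_c\in\mathcal X$ with $T\subseteq T_c$ and $\mathrm{Con}_{\mathrm{sat}}(T_c+p{\uparrow}/T_0)$. A structure is $\mathrm{Con}_{\mathrm{sat}}$-saturated if it is $\mathcal X$-saturated for some $\mathrm{Con}_{\mathrm{sat}}$-closed Scott set $\mathcal X$. A structure $M$ is strongly homogeneous if whenever finite tuples $\bar a,\bar b$ of $M$ have the same type, some automorphism of $M$ maps $\bar a$ to $\bar b$. A structure $M$ in a recursive language $\mathcal L$ is transcendent if it is strongly homogeneous and there is a Scott set $\mathcal X$ such that $M$ is $\mathcal X$-saturated and, for every recursive extension $\mathcal L^+$ of $\mathcal L$, every first-order $\mathcal L^+$-theory $T\in\mathcal X$ and every $\mathcal L^+$-type $p(\bar x)\in\mathcal X$ with $\mathrm{Con}_{\mathrm{sat}}(T+p{\uparrow}/\mathrm{Th}(M))$, there is an expansion $M^+$ of $M$ to $\mathcal L^+$ with $M^+\models T+p{\uparrow}$. *)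

(* Defs.v *)
From Stdlib Require Import List Arith Bool.
Import ListNotations.

(* Symbols are natural numbers; a language gives, for each code, whether it is a
   relation (resp. function) symbol and its arity. Constants = 0-ary functions. *)
Record lang := Lang { rel_ar : nat -> option nat; fun_ar : nat -> option nat }.

Inductive code :=
| CZero | CSucc | CProj (i : nat) | COrac
| CComp (f : code) (gs : list code)
| CRec (f g : code)
| CMu (f : code).

Inductive eval (o : nat -> nat) : code -> list nat -> nat -> Prop :=
| ev_zero v : eval o CZero v 0
| ev_succ x v : eval o CSucc (x :: v) (S x)
| ev_proj i v : i < length v -> eval o (CProj i) v (nth i v 0)
| ev_orac x v : eval o COrac (x :: v) (o x)
| ev_comp f gs v ws y :
    Forall2 (fun g w => eval o g v w) gs ws -> eval o f ws y ->
    eval o (CComp f gs) v y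
| ev_rec0 f g v y : eval o f v y -> eval o (CRec f g) (0 :: v) y
| ev_recS f g n v y z :
    eval o (CRec f g) (n :: v) y -> eval o g (n :: y :: v) z ->
    eval o (CRec f g) (S n :: v) z
| ev_mu f v n :
    eval o f (n :: v) 0 ->
    (forall m, m < n -> exists k, eval o f (m :: v) (S k)) ->
    eval o (CMu f) v n.

Definition chi (A : nat -> bool) (n : nat) : nat := if A n then 1 else 0.

Definition turing_le (A B : nat -> bool) : Prop :=
  exists c, forall x, eval (chi B) c [x] (chi A x).

(* total recursive function (no oracle used: the oracle is the constant 0) *)
Definition computable (f : nat -> nat) : Prop :=
  exists c, forall x, eval (fun _ => 0) c [x] (f x).

Definition code_opt (o : option nat) : nat :=
  match o with None => 0 | Some m => S m end.

Definition recursive_lang (L : lang) : Prop :=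
  computable (fun n => code_opt (rel_ar L n)) /\
  computable (fun n => code_opt (fun_ar L n)).

Definition extends (L L' : lang) : Prop :=
  (forall i m, rel_ar L i = Some m -> rel_ar L' i = Some m) /\
  (forall i m, fun_ar L i = Some m -> fun_ar L' i = Some m).

Inductive term := Var (n : nat) | App (f : nat) (ts : list term).

Inductive form :=
| Fal
| Eqf (t u : term)
| Rel (r : nat) (ts : list term)
| Neg (p : form)
| Imp (p q : form)
| Conj (p q : form)
| Disj (p q : form)
| All (x : nat) (p : form)
| Ex (x : nat) (p : form).

Definition ar_is (o : option nat) (n : nat) : bool :=
  match o with Some m => Nat.eqb m n | None => false end.

Fixpoint twf (L : lang) (t : term) : bool :=
  match t with
  | Var _ => true
  | App f ts => ar_is (fun_ar L f) (length ts) && forallb (twf L) ts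
  end.

Fixpoint fwf (L : lang) (p : form) : bool :=
  match p with
  | Fal => true
  | Eqf t u => twf L t && twf L u
  | Rel r ts => ar_is (rel_ar L r) (length ts) && forallb (twf L) ts
  | Neg q => fwf L q
  | Imp q r | Conj q r | Disj q r => fwf L q && fwf L r
  | All _ q | Ex _ q => fwf L q
  end.

Fixpoint tocc (x : nat) (t : term) : bool :=
  match t with
  | Var n => Nat.eqb n x
  | App _ ts => existsb (tocc x) ts
  end.

Fixpoint free (x : nat) (p : form) : bool :=
  match p with
  | Fal => false
  | Eqf t u => tocc x t || tocc x u
  | Rel _ ts => existsb (tocc x) ts
  | Neg q => free x q
  | Imp q r | Conj q r | Disj q r => free x q || free x r
  | All y q | Ex y q => negb (Nat.eqb y x) && free x q
  end.

Definition is_form (L : lang) (n : nat) (p : form) : Prop :=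
  fwf L p = true /\ (forall x, free x p = true -> x < n).

Definition cp (a b : nat) : nat := (a + b) * (a + b + 1) / 2 + b.

Fixpoint enc_term (t : term) : nat :=
  match t with
  | Var n => cp 0 n
  | App f ts => cp 1 (cp f (fold_right (fun u acc => S (cp (enc_term u) acc)) 0 ts))
  end.

Definition enc_terms (ts : list term) : nat :=
  fold_right (fun u acc => S (cp (enc_term u) acc)) 0 ts.

Fixpoint enc (p : form) : nat :=
  match p with
  | Fal => cp 0 0
  | Eqf t u => cp 1 (cp (enc_term t) (enc_term u))
  | Rel r ts => cp 2 (cp r (enc_terms ts))
  | Neg q => cp 3 (enc q)
  | Imp q r => cp 4 (cp (enc q) (enc r))
  | Conj q r => cp 5 (cp (enc q) (enc r))
  | Disj q r => cp 6 (cp (enc q) (enc r))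
  | All x q => cp 7 (cp x (enc q))
  | Ex x q => cp 8 (cp x (enc q))
  end.

Definition mem (S : nat -> bool) (p : form) : Prop := S (enc p) = true.

Definition theory (L : lang) (S : nat -> bool) : Prop :=
  forall k, S k = true -> exists p, enc p = k /\ is_form L 0 p.

Definition type_in (L : lang) (n : nat) (S : nat -> bool) : Prop :=
  forall k, S k = true -> exists p, enc p = k /\ is_form L n p.

Definition complete (L : lang) (S : nat -> bool) : Prop :=
  forall p, is_form L 0 p -> mem S p \/ mem S (Neg p).

Record structure (A : Type) := Struct
  { srel : nat -> list A -> Prop; sfun : nat -> list A -> A }.
Arguments srel {A} _ _ _.
Arguments sfun {A} _ _ _.

Fixpoint teval {A} (M : structure A) (s : nat -> A) (t : term) : A :=
  match t with
  | Var n => s n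
  | App f ts => sfun M f (map (teval M s) ts)
  end.

Definition upd {A} (s : nat -> A) (x : nat) (a : A) : nat -> A :=
  fun y => if Nat.eqb y x then a else s y.

Fixpoint sat {A} (M : structure A) (s : nat -> A) (p : form) : Prop :=
  match p with
  | Fal => False
  | Eqf t u => teval M s t = teval M s u
  | Rel r ts => srel M r (map (teval M s) ts)
  | Neg q => ~ sat M s q
  | Imp q r => sat M s q -> sat M s r
  | Conj q r => sat M s q /\ sat M s r
  | Disj q r => sat M s q \/ sat M s r
  | All x q => forall a, sat M (upd s x a) q
  | Ex x q => exists a, sat M (upd s x a) q
  end.

Definition models {A} (M : structure A) (S : nat -> bool) : Prop :=
  forall p, mem S p -> forall s, sat M s p.

Definition omits {A} (M : structure A) (P : nat -> bool) : Prop :=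
  forall s : nat -> A, exists p, mem P p /\ ~ sat M s p.

Definition consistent (S : nat -> bool) : Prop :=
  exists (B : Type) (N : structure B), inhabited B /\ models N S.

Definition Th {A} (L : lang) (M : structure A) : form -> Prop :=
  fun p => is_form L 0 p /\ forall s, sat M s p.

Definition scons {A} (b : A) (a : nat -> A) : nat -> A :=
  fun i => match i with 0 => b | S j => a j end.

(* omega-saturation of the L-reduct: every 1-type (in x_0) over finitely many
   parameters a_0..a_{k-1} (variables x_1..x_k) finitely satisfiable in M
   is realized in M. *)
Definition omega_saturated {A} (L : lang) (M : structure A) : Prop :=
  forall (k : nat) (a : nat -> A) (q : form -> Prop),
    (forall p, q p -> is_form L (S k) p) ->
    (forall l : list form, (forall p, In p l -> q p) ->
        exists b, forall p, In p l -> sat M (scons b a) p) ->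
    exists b, forall p, q p -> sat M (scons b a) p.

Definition Con_sat (L : lang) (T0 : form -> Prop) (T P : nat -> bool) : Prop :=
  exists (B : Type) (N : structure B),
    inhabited B /\ (forall p, T0 p -> forall s, sat N s p) /\
    models N T /\ omits N P /\ omega_saturated L N.

Definition scott (X : (nat -> bool) -> Prop) : Prop :=
  (exists A, X A) /\
  (forall A B, X A -> X B -> X (fun n => orb (A n) (B n))) /\
  (forall A, X A -> X (fun n => negb (A n))) /\
  (forall A B, X A -> turing_le B A -> X B) /\
  (forall L T, recursive_lang L -> theory L T -> X T -> consistent T ->
     exists T', X T' /\ theory L T' /\ (forall k, T k = true -> T' k = true) /\
                complete L T' /\ consistent T').

(* tuple (x_0..x_{n-1}) followed by parameters (x_n..x_{n+k-1}) *)
Definition join {A} (n : nat) (b a : nat -> A) : nat -> A :=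
  fun i => if i <? n then b i else a (i - n).

(* P(x,y) with y := a is a complete type over M in variables x_0..x_{n-1}
   with parameters a_0..a_{k-1} *)
Definition complete_type {A} (L : lang) (M : structure A) (n k : nat)
    (a : nat -> A) (P : nat -> bool) : Prop :=
  type_in L (n + k) P /\
  (forall l : list form, (forall p, In p l -> mem P p) ->
      exists b, forall p, In p l -> sat M (join n b a) p) /\
  (forall p, is_form L (n + k) p -> mem P p \/ mem P (Neg p)).

Definition X_saturated {A} (L : lang) (X : (nat -> bool) -> Prop)
    (M : structure A) : Prop :=
  forall n k (a : nat -> A) (P : nat -> bool),
    complete_type L M n k a P ->
    ((exists b : nat -> A, forall p, mem P p -> sat M (join n b a) p) <-> X P).

Definition Con_sat_closed (X : (nat -> bool) -> Prop) : Prop :=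
  scott X /\
  forall (L L' : lang) (T0 T : nat -> bool) (n : nat) (P : nat -> bool),
    recursive_lang L -> recursive_lang L' -> extends L L' ->
    theory L T0 -> X T0 -> theory L' T -> X T -> type_in L' n P -> X P ->
    Con_sat L (mem T0) T P ->
    exists Tc, X Tc /\ theory L' Tc /\ complete L' Tc /\
               (forall k, T k = true -> Tc k = true) /\
               Con_sat L (mem T0) Tc P.

Definition Con_sat_saturated {A} (L : lang) (M : structure A) : Prop :=
  exists X, Con_sat_closed X /\ X_saturated L X M.

Definition automorphism {A} (L : lang) (M : structure A) (f : A -> A) : Prop :=
  (exists g : A -> A, (forall x, g (f x) = x) /\ (forall y, f (g y) = y)) /\
  (forall r m (l : list A), rel_ar L r = Some m -> length l = m ->
      (srel M r l <-> srel M r (map f l))) /\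
  (forall h m (l : list A), fun_ar L h = Some m -> length l = m ->
      f (sfun M h l) = sfun M h (map f l)).

Definition strongly_homogeneous {A} (L : lang) (M : structure A) : Prop :=
  forall n (a b : nat -> A),
    (forall p, is_form L n p -> (sat M a p <-> sat M b p)) ->
    exists f, automorphism L M f /\ forall i, i < n -> f (a i) = b i.

Definition expansion {A} (L : lang) (M M' : structure A) : Prop :=
  (forall r m (l : list A), rel_ar L r = Some m -> length l = m ->
      (srel M' r l <-> srel M r l)) /\
  (forall h m (l : list A), fun_ar L h = Some m -> length l = m ->
      sfun M' h l = sfun M h l).

Definition transcendent {A} (L : lang) (M : structure A) : Prop :=
  strongly_homogeneous L M /\
  exists X, scott X /\ X_saturated L X M /\
    forall (L' : lang) (T : nat -> bool) (n : nat) (P : nat -> bool),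
      recursive_lang L' -> extends L L' ->
      theory L' T -> X T -> type_in L' n P -> X P ->
      Con_sat L (Th L M) T P ->
      exists M' : structure A, expansion L M M' /\ models M' T /\ omits M' P.

Definition countable (A : Type) : Prop :=
  exists f : A -> nat, forall x y, f x = f y -> x = y.

(* Main.v *)
From Stdlib Require Import List Arith Bool Lia Classical ClassicalEpsilon.
Require Import Defs.
Import ListNotations.

(** Strong homogeneity is a back-and-forth: the type of a finite tuple belongs to
    [X] because it is realized, hence its copies over other parameters are realized.

    For the expansion, enumerate [A] and build an increasing sequence of complete
    theories [T_k] in [X], in the language [L'] with constants [c_0, ..., c_(k-1)]
    naming elements [e_0, ..., e_(k-1)] of [M], such that [T_k] contains the type of
    these elements in [L] and is true in some model that omits [P] and whose
    [L]-reduct is omega-saturated. A given element of [M] can be named next because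
    the saturated model realizes the corresponding type. A Henkin witness can be
    added because, after completing the theory inside [X], the [L]-type of the new
    constant is in [X] and so is realized in [M] by X-saturation. In the limit every
    element is named and every existential sentence has a witness, so [M] itself
    carries the limit structure. Each [T_k] is complete and has a model omitting [P],
    so it already refutes some formula of [P] at every tuple of constants it
    mentions: [P] needs no bookkeeping. *)

(** * Cantor pairing and computable functions *)

(** [L'] may already use every number as a symbol, so there is room for constants only after its
    symbols are renamed, and the renamed theories must again lie in [X]. A Scott set gives closure
    under Turing reducibility and nothing finer; this is why renaming and substitution are computed
    on codes, relative to an arbitrary oracle.

    Omitting [P] is not first-order and does not survive compactness, so finite consistency cannot
    justify a stage: each one is certified by an actual model. Models of different stages need not
    be related, so the limit is read off from the increasing complete theories and not from a chain
    of models.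

    The constants enter only the larger language. The base language and base theory in [Con_sat]
    stay fixed throughout, because omega-saturation already allows finitely many parameters and the
    values of the constants can serve as these. *)

Fixpoint tri (n : nat) : nat := match n with 0 => 0 | S m => S m + tri m end.

Lemma tri_double n : n * (n + 1) = tri n * 2.
Proof. induction n; simpl tri; lia. Qed.

Lemma cp_tri a b : cp a b = tri (a + b) + b.
Proof. unfold cp. rewrite tri_double, Nat.div_mul; lia. Qed.

Opaque cp.

Lemma le_tri n : n <= tri n.
Proof. induction n; simpl; lia. Qed.

Lemma tri_le a b : a <= b -> tri a <= tri b.
Proof. induction 1; simpl; lia. Qed.

(* The index of the diagonal of the Cantor pairing on which [z] lies. *)
Fixpoint diag (z : nat) : nat :=
  match z with
  | 0 => 0
  | S y => if S y =? tri (S (diag y)) then S (diag y) else diag y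
  end.

Lemma diag_spec z : tri (diag z) <= z < tri (S (diag z)).
Proof.
  induction z as [|z IH]; [simpl; lia|]. cbn [diag].
  destruct (Nat.eqb_spec (S z) (tri (S (diag z)))) as [E|E].
  - split; [lia|]. simpl in *; lia.
  - lia.
Qed.

Definition psnd (z : nat) : nat := z - tri (diag z).
Definition pfst (z : nat) : nat := diag z - psnd z.

Lemma cp_pfst_psnd z : cp (pfst z) (psnd z) = z.
Proof.
  pose proof (diag_spec z) as D. simpl in D.
  rewrite cp_tri. unfold pfst, psnd in *.
  replace (diag z - (z - tri (diag z)) + (z - tri (diag z))) with (diag z) by lia.
  lia.
Qed.

Lemma diag_cp a b : diag (cp a b) = a + b.
Proof.
  rewrite cp_tri. pose proof (diag_spec (tri (a + b) + b)) as D.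
  set (d := diag _) in *. simpl in D.
  destruct (lt_eq_lt_dec d (a + b)) as [[H|H]|H]; auto.
  - pose proof (tri_le (S d) (a + b) H) as E. simpl in E. lia.
  - pose proof (tri_le (S (a + b)) d H) as E. simpl in E. lia.
Qed.

Lemma psnd_cp a b : psnd (cp a b) = b.
Proof. unfold psnd. rewrite diag_cp, cp_tri. lia. Qed.

Lemma pfst_cp a b : pfst (cp a b) = a.
Proof. unfold pfst. rewrite diag_cp, psnd_cp. lia. Qed.

Lemma cp_inj a b c d : cp a b = cp c d -> a = c /\ b = d.
Proof.
  intros H. split.
  - now rewrite <- (pfst_cp a b), H, pfst_cp.
  - now rewrite <- (psnd_cp a b), H, psnd_cp.
Qed.

Lemma cp_ge a b : a + b <= cp a b.
Proof. rewrite cp_tri. pose proof (le_tri (a + b)). lia. Qed.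

Lemma cp_mono a b c d : a <= c -> b <= d -> cp a b <= cp c d.
Proof.
  intros. rewrite !cp_tri. pose proof (tri_le (a + b) (c + d)). lia.
Qed.

Definition ifz (x a b : nat) : nat := match x with 0 => a | S _ => b end.
Definition ifeq (x y a b : nat) : nat := if x =? y then a else b.

(** * Basic programs and closure properties of functions computable in an oracle *)

Section Programs.
Variable o : nat -> nat.

Lemma eval_proj i v y : i < length v -> nth i v 0 = y -> eval o (CProj i) v y.
Proof. intros H <-. now constructor. Qed.

Lemma eval_comp1 f g v a y :
  eval o g v a -> eval o f [a] y -> eval o (CComp f [g]) v y.
Proof. intros. econstructor; eauto. Qed.

Lemma eval_comp2 f g h v a b y :
  eval o g v a -> eval o h v b -> eval o f [a; b] y -> eval o (CComp f [g; h]) v y.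
Proof. intros. econstructor; eauto. Qed.

Lemma eval_comp3 f g h i v a b c y :
  eval o g v a -> eval o h v b -> eval o i v c -> eval o f [a; b; c] y ->
  eval o (CComp f [g; h; i]) v y.
Proof. intros. econstructor; eauto. Qed.

Ltac pj := apply eval_proj; [simpl; lia | reflexivity].

Definition cAdd := CRec (CProj 0) (CComp CSucc [CProj 1]).
Lemma eval_add x y : eval o cAdd [x; y] (x + y).
Proof.
  induction x; simpl.
  - constructor. pj.
  - econstructor; [eassumption|]. eapply eval_comp1; [pj | constructor].
Qed.

Definition cPred := CRec CZero (CProj 0).
Lemma eval_pred x : eval o cPred [x] (pred x).
Proof.
  induction x; simpl.
  - constructor. constructor.
  - econstructor; [eassumption|]. pj.
Qed.

(** Primitive recursion descends on the head of the argument list, so the subtrahend comes first. *)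
Definition cSub := CRec (CProj 0) (CComp cPred [CProj 1]).
Lemma eval_sub x y : eval o cSub [x; y] (y - x).
Proof.
  induction x; simpl.
  - constructor. rewrite Nat.sub_0_r. pj.
  - econstructor; [eassumption|]. eapply eval_comp1; [pj|].
    replace (y - S x) with (pred (y - x)) by lia. apply eval_pred.
Qed.

Definition cTri := CRec CZero (CComp cAdd [CComp CSucc [CProj 0]; CProj 1]).
Lemma eval_tri x : eval o cTri [x] (tri x).
Proof.
  induction x; simpl.
  - constructor. constructor.
  - econstructor; [eassumption|].
    eapply eval_comp2; [eapply eval_comp1; [pj|constructor] | pj | apply (eval_add (S x))].
Qed.

(** The step receives the predecessor, the previous value, [a] and [b], so [CProj 3] returns [b]. *)
Definition cIf := CRec (CProj 0) (CProj 3).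
Lemma eval_if x a b : eval o cIf [x; a; b] (ifz x a b).
Proof.
  induction x; simpl.
  - constructor. pj.
  - econstructor; [eassumption|]. pj.
Qed.

Definition cDist := CComp cAdd [CComp cSub [CProj 0; CProj 1]; CComp cSub [CProj 1; CProj 0]].
Lemma eval_dist x y : eval o cDist [x; y] ((y - x) + (x - y)).
Proof.
  eapply eval_comp2; [| |apply eval_add].
  - eapply eval_comp2; [pj|pj|apply eval_sub].
  - eapply eval_comp2; [pj|pj|apply eval_sub].
Qed.

Definition cDiag :=
  CRec CZero (CComp cIf
    [CComp cDist [CComp CSucc [CProj 0]; CComp cTri [CComp CSucc [CProj 1]]];
     CComp CSucc [CProj 1]; CProj 1]).
Lemma eval_diag x : eval o cDiag [x] (diag x).
Proof.
  induction x.
  - constructor. constructor.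
  - econstructor; [eassumption|].
    eapply eval_comp3.
    + eapply eval_comp2; [eapply eval_comp1; [pj|constructor]| |apply eval_dist].
      eapply eval_comp1; [eapply eval_comp1; [pj|constructor]|apply eval_tri].
    + eapply eval_comp1; [pj|constructor].
    + pj.
    + cbn [diag nth].
      match goal with |- eval o cIf [?d; ?a; ?b] _ =>
        replace (if S x =? tri (S (diag x)) then S (diag x) else diag x) with (ifz d a b)
      end; [apply eval_if|].
      destruct (Nat.eqb_spec (S x) (tri (S (diag x)))) as [E|E].
      * rewrite E, Nat.sub_diag. reflexivity.
      * unfold ifz. destruct (tri (S (diag x)) - S x + (S x - tri (S (diag x)))) eqn:F; lia.
Qed.

Definition cSnd := CComp cSub [CComp cTri [cDiag]; CProj 0].
Lemma eval_snd x : eval o cSnd [x] (psnd x).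
Proof.
  eapply eval_comp2; [|pj|apply eval_sub].
  eapply eval_comp1; [apply eval_diag|apply eval_tri].
Qed.

Definition cFst := CComp cSub [cSnd; cDiag].
Lemma eval_fst x : eval o cFst [x] (pfst x).
Proof. eapply eval_comp2; [apply eval_snd|apply eval_diag|apply eval_sub]. Qed.

Opaque pfst psnd.

Definition cPair := CComp cAdd [CComp cTri [cAdd]; CProj 1].
Lemma eval_pair x y : eval o cPair [x; y] (cp x y).
Proof.
  rewrite cp_tri. eapply eval_comp2; [|pj|apply eval_add].
  eapply eval_comp1; [apply eval_add|apply eval_tri].
Qed.

(** Unary functions suffice: further arguments are packed by [cp] and recovered by [pfst] and
    [psnd]. *)
Definition cmp (f : nat -> nat) : Prop := exists c, forall x, eval o c [x] (f x).

Lemma cmp_ext f g : (forall x, f x = g x) -> cmp f -> cmp g.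
Proof. intros E [c H]. exists c. intros x. rewrite <- E. apply H. Qed.

Lemma cmp_id : cmp (fun x => x).
Proof. exists (CProj 0). intros x. pj. Qed.

Lemma cmp_S f : cmp f -> cmp (fun x => S (f x)).
Proof.
  intros [c H]. exists (CComp CSucc [c]). intros x.
  eapply eval_comp1; [apply H|constructor].
Qed.

Lemma cmp_const n : cmp (fun _ => n).
Proof.
  induction n.
  - exists CZero. constructor.
  - now apply cmp_S.
Qed.

Lemma cmp_orac f : cmp f -> cmp (fun x => o (f x)).
Proof.
  intros [c H]. exists (CComp COrac [c]). intros x.
  eapply eval_comp1; [apply H|constructor].
Qed.

Lemma cmp_comp g f : cmp g -> cmp f -> cmp (fun x => g (f x)).
Proof.
  intros [d G] [c H]. exists (CComp d [c]). intros x.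
  eapply eval_comp1; [apply H|apply G].
Qed.

Lemma cmp_pred f : cmp f -> cmp (fun x => pred (f x)).
Proof. apply (cmp_comp pred). exists cPred. exact eval_pred. Qed.

Lemma cmp_pfst f : cmp f -> cmp (fun x => pfst (f x)).
Proof. apply (cmp_comp pfst). exists cFst. exact eval_fst. Qed.

Lemma cmp_psnd f : cmp f -> cmp (fun x => psnd (f x)).
Proof. apply (cmp_comp psnd). exists cSnd. exact eval_snd. Qed.

Lemma cmp_cp f g : cmp f -> cmp g -> cmp (fun x => cp (f x) (g x)).
Proof.
  intros [c H] [d G]. exists (CComp cPair [c; d]). intros x.
  eapply eval_comp2; [apply H|apply G|apply eval_pair].
Qed.

Lemma cmp_sub f g : cmp f -> cmp g -> cmp (fun x => f x - g x).
Proof.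
  intros [c H] [d G]. exists (CComp cSub [d; c]). intros x.
  eapply eval_comp2; [apply G|apply H|apply eval_sub].
Qed.

Lemma cmp_ifz f g h :
  cmp f -> cmp g -> cmp h -> cmp (fun x => ifz (f x) (g x) (h x)).
Proof.
  intros [c H] [d G] [e K]. exists (CComp cIf [c; d; e]). intros x.
  eapply eval_comp3; [apply H|apply G|apply K|apply eval_if].
Qed.

Lemma cmp_ifeq f1 f2 g h :
  cmp f1 -> cmp f2 -> cmp g -> cmp h -> cmp (fun x => ifeq (f1 x) (f2 x) (g x) (h x)).
Proof.
  intros H1 H2 G K.
  apply (cmp_ext (fun x => ifz (f1 x - f2 x) (ifz (f2 x - f1 x) (g x) (h x)) (h x))).
  - intros x. unfold ifeq, ifz.
    destruct (Nat.eqb_spec (f1 x) (f2 x)) as [E|E].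
    + now rewrite E, Nat.sub_diag.
    + destruct (f1 x - f2 x) eqn:A; auto. destruct (f2 x - f1 x) eqn:B; auto. lia.
  - repeat apply cmp_ifz; auto; now apply cmp_sub.
Qed.

(** The step depends on index, accumulator and parameter, so its unary program is fed this triple
    packed by [cp]. *)
Lemma cmp_rec (b h : nat -> nat) (G : nat -> nat -> nat -> nat) :
  cmp b -> cmp h -> cmp (fun z => G (pfst z) (pfst (psnd z)) (psnd (psnd z))) ->
  cmp (fun x => nat_rect (fun _ => nat) (b x) (fun i acc => G i acc x) (h x)).
Proof.
  intros [cb B] [ch H] [cg K].
  exists (CComp (CRec cb (CComp cg [CComp cPair [CProj 0; CComp cPair [CProj 1; CProj 2]]]))
            [ch; CProj 0]).
  intros x. eapply eval_comp2; [apply H|pj|].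
  generalize (h x) as n. cbn [nth].
  induction n as [|n IH]; simpl.
  - constructor. apply B.
  - econstructor; [exact IH|]. eapply eval_comp1.
    + eapply eval_comp2; [pj| |apply eval_pair].
      eapply eval_comp2; [pj|pj|apply eval_pair].
    + specialize (K (cp n (cp (nat_rect (fun _ => nat) (b x) (fun i acc => G i acc x) n) x))).
      rewrite pfst_cp, psnd_cp, pfst_cp, psnd_cp in K. exact K.
Qed.

(* Course-of-values recursion: the history before [m] is the stack of earlier
   values, latest on top. *)
Fixpoint hist (st : nat -> nat -> nat) (m : nat) : nat :=
  match m with 0 => 0 | S n => cp (st n (hist st n)) (hist st n) end.

(** The value at [i] lies [m - S i] entries below the top of the stack. *)
Definition lookup (m h i : nat) : nat :=
  pfst (nat_rect (fun _ => nat) h (fun _ acc => psnd acc) (m - S i)).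

Definition cov (st : nat -> nat -> nat) (m : nat) : nat := st m (hist st m).

Lemma lookup_hist st m i : i < m -> lookup m (hist st m) i = cov st i.
Proof.
  unfold lookup, cov. induction m as [|m IH]; intros H; [lia|].
  destruct (Nat.eq_dec i m) as [->|N].
  - rewrite Nat.sub_diag. cbn. now rewrite pfst_cp.
  - replace (S m - S i) with (S (m - S i)) by lia.
    rewrite <- (IH ltac:(lia)). f_equal. cbn [hist nat_rect].
    generalize (m - S i) as n. induction n as [|n IHn]; cbn [nat_rect].
    + now rewrite psnd_cp.
    + now rewrite IHn.
Qed.

Lemma cmp_lookup f g h :
  cmp f -> cmp g -> cmp h -> cmp (fun x => lookup (f x) (g x) (h x)).
Proof.
  intros. unfold lookup. apply cmp_pfst.
  apply (cmp_rec g (fun x => f x - S (h x)) (fun _ acc _ => psnd acc)); auto.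
  - apply cmp_sub; auto. now apply cmp_S.
  - apply cmp_psnd, cmp_pfst, cmp_psnd, cmp_id.
Qed.

Lemma cmp_cov st : cmp (fun z => st (pfst z) (psnd z)) -> cmp (cov st).
Proof.
  intros H.
  assert (K : cmp (hist st)).
  { apply (cmp_ext (fun x => nat_rect (fun _ => nat) 0 (fun i acc => cp (st i acc) acc) x)).
    - intros x. induction x; simpl; congruence.
    - apply (cmp_rec (fun _ => 0) (fun x => x) (fun i acc _ => cp (st i acc) acc)).
      + apply cmp_const.
      + apply cmp_id.
      + apply cmp_cp; [|apply cmp_pfst, cmp_psnd, cmp_id].
        apply (cmp_ext (fun z => (fun y => st (pfst y) (psnd y)) (cp (pfst z) (pfst (psnd z))))).
        * intros x. now rewrite pfst_cp, psnd_cp.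
        * apply (cmp_comp (fun y => st (pfst y) (psnd y))); auto.
          apply cmp_cp; [apply cmp_pfst, cmp_id|apply cmp_pfst, cmp_psnd, cmp_id]. }
  apply (cmp_ext (fun x => (fun y => st (pfst y) (psnd y)) (cp x (hist st x)))).
  - intros x. now rewrite pfst_cp, psnd_cp.
  - apply (cmp_comp (fun y => st (pfst y) (psnd y))); auto.
    apply cmp_cp; [apply cmp_id|exact K].
Qed.

End Programs.

Ltac cmp_auto :=
  repeat first
    [ assumption | apply cmp_lookup | apply cmp_id | apply cmp_const | apply cmp_S | apply cmp_pred
    | apply cmp_pfst | apply cmp_psnd | apply cmp_cp | apply cmp_sub
    | apply cmp_ifz | apply cmp_ifeq ].

(** * Renaming of symbols, new constants, and substitution by quantifiers *)

Lemma term_ind_list (Q : term -> Prop) :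
  (forall n, Q (Var n)) -> (forall f ts, Forall Q ts -> Q (App f ts)) -> forall t, Q t.
Proof.
  intros HV HA. fix IH 1. intros [n|f ts].
  - apply HV.
  - apply HA. induction ts as [|t ts IHts]; constructor; [apply IH|exact IHts].
Qed.

Lemma enc_terms_inj_Forall ts :
  Forall (fun t => forall u, enc_term t = enc_term u -> t = u) ts ->
  forall us, enc_terms ts = enc_terms us -> ts = us.
Proof.
  induction 1 as [|t ts Ht _ IH]; intros [|u us] E; simpl in E; try discriminate; auto.
  injection E as E. apply cp_inj in E as [E1 E2]. f_equal; auto.
Qed.

Lemma enc_term_inj t : forall u, enc_term t = enc_term u -> t = u.
Proof.
  induction t as [n|f ts IH] using term_ind_list; intros [m|g us] E;
    simpl in E; apply cp_inj in E as [E1 E2]; try discriminate; try congruence.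
  apply cp_inj in E2 as [-> E2].
  f_equal. now apply enc_terms_inj_Forall.
Qed.

Lemma enc_terms_inj ts us : enc_terms ts = enc_terms us -> ts = us.
Proof. apply enc_terms_inj_Forall, Forall_forall. intros t _. apply enc_term_inj. Qed.

Lemma enc_inj p : forall q, enc p = enc q -> p = q.
Proof.
  induction p; intros q' E; destruct q'; simpl in E;
    apply cp_inj in E as [E1 E2]; try discriminate; try reflexivity.
  - apply cp_inj in E2 as [E2 E3]. f_equal; now apply enc_term_inj.
  - apply cp_inj in E2 as [E2 E3]. f_equal; auto. now apply enc_terms_inj.
  - f_equal; auto.
  - apply cp_inj in E2 as [E2 E3]. f_equal; auto.
  - apply cp_inj in E2 as [E2 E3]. f_equal; auto.
  - apply cp_inj in E2 as [E2 E3]. f_equal; auto.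
  - apply cp_inj in E2 as [E2 E3]. f_equal; auto.
  - apply cp_inj in E2 as [E2 E3]. f_equal; auto.
Qed.

(* A language may already use every number as a symbol. To make room for new
   constants, [f] is renamed [cp 0 f], and the constants are [cp 1 i]. *)
Fixpoint rnt (t : term) : term :=
  match t with
  | Var n => Var n
  | App f ts => App (cp 0 f) (map rnt ts)
  end.

Fixpoint rn (p : form) : form :=
  match p with
  | Fal => Fal
  | Eqf t u => Eqf (rnt t) (rnt u)
  | Rel r ts => Rel r (map rnt ts)
  | Neg q => Neg (rn q)
  | Imp q r => Imp (rn q) (rn r)
  | Conj q r => Conj (rn q) (rn r)
  | Disj q r => Disj (rn q) (rn r)
  | All x q => All x (rn q)
  | Ex x q => Ex x (rn q)
  end.

Definition cst (i : nat) : term := App (cp 1 i) [].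

(** No relation symbol is ever added, so only function symbols are shifted. [Lc L 0] is a renamed
    copy of [L] without constants. *)
Definition Lc (L : lang) (k : nat) : lang :=
  Lang (rel_ar L) (fun s =>
    if pfst s =? 0 then fun_ar L (psnd s)
    else if pfst s =? 1 then (if psnd s <? k then Some 0 else None) else None).

Lemma fun_ar_Lc_old L k f : fun_ar (Lc L k) (cp 0 f) = fun_ar L f.
Proof. simpl. now rewrite pfst_cp, psnd_cp. Qed.

Lemma fun_ar_Lc_new L k i : i < k -> fun_ar (Lc L k) (cp 1 i) = Some 0.
Proof.
  intros H. simpl. rewrite pfst_cp, psnd_cp. simpl.
  apply Nat.ltb_lt in H. now rewrite H.
Qed.

Lemma extends_Lc L L' k k' : extends L L' -> k <= k' -> extends (Lc L k) (Lc L' k').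
Proof.
  intros [HR HF] Hk. split; simpl; auto.
  intros s m. destruct (pfst s =? 0); auto. destruct (pfst s =? 1); auto.
  destruct (Nat.ltb_spec (psnd s) k); destruct (Nat.ltb_spec (psnd s) k'); auto; try discriminate; lia.
Qed.

Lemma extends_refl L : extends L L.
Proof. split; auto. Qed.

Lemma recursive_Lc L k : recursive_lang L -> recursive_lang (Lc L k).
Proof.
  intros [HR [c HF]]. split; auto.
  change (cmp (fun _ => 0) (fun n => code_opt (fun_ar (Lc L k) n))).
  (* The test [psnd n < k] becomes the vanishing of [S (psnd n) - k], and the value 1 is
     [code_opt (Some 0)], the code of a constant. *)
  apply (cmp_ext _ (fun n => ifeq (pfst n) 0 ((fun y => code_opt (fun_ar L y)) (psnd n))
     (ifeq (pfst n) 1 (ifz (S (psnd n) - k) 1 0) 0))).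
  - intros n. cbn [Lc fun_ar]. unfold ifeq.
    destruct (pfst n =? 0); auto. destruct (pfst n =? 1); auto.
    destruct (Nat.ltb_spec (psnd n) k).
    + destruct (S (psnd n) - k) eqn:E; [reflexivity|lia].
    + destruct (S (psnd n) - k) eqn:E; [lia|reflexivity].
  - assert (cmp (fun _ => 0) (fun n => (fun y => code_opt (fun_ar L y)) (psnd n))).
    { apply (cmp_comp _ (fun y => code_opt (fun_ar L y))); [now exists c|cmp_auto]. }
    cmp_auto.
Qed.

Lemma ar_is_some o n : ar_is o n = true -> o = Some n.
Proof. destruct o; simpl; [|discriminate]. intros H. apply Nat.eqb_eq in H. congruence. Qed.

Lemma some_ar_is o n : o = Some n -> ar_is o n = true.
Proof. intros ->. apply Nat.eqb_refl. Qed.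

Ltac bools :=
  repeat match goal with
  | H : (_ && _) = true |- _ => apply andb_true_iff in H as [? ?]
  | H : (_ || _) = false |- _ => apply orb_false_iff in H as [? ?]
  | |- (_ && _) = true => apply andb_true_iff; split
  end.

Lemma forallb_Forall {X} (f : X -> bool) l : forallb f l = true <-> Forall (fun x => f x = true) l.
Proof. rewrite forallb_forall, Forall_forall. reflexivity. Qed.

Lemma existsb_intro {X} (f : X -> bool) l x : In x l -> f x = true -> existsb f l = true.
Proof. intros. apply existsb_exists. eauto. Qed.

Lemma twf_extends L L' t : extends L L' -> twf L t = true -> twf L' t = true.
Proof.
  intros [_ HF]. induction t as [n|f ts IH] using term_ind_list; simpl; auto.
  intros H; bools.
  - apply some_ar_is, HF, ar_is_some; auto.
  - rewrite forallb_Forall in *. rewrite Forall_forall in *. auto.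
Qed.

Lemma fwf_extends L L' p : extends L L' -> fwf L p = true -> fwf L' p = true.
Proof.
  intros E. induction p; simpl; intros; bools; auto; try (eapply twf_extends; eauto; fail).
  - destruct E as [HR HF]. apply some_ar_is, HR, ar_is_some; auto.
  - rewrite forallb_Forall in *. eapply Forall_impl; [|eassumption].
    intros t; now apply twf_extends.
Qed.

Lemma is_form_extends L L' n n' p :
  extends L L' -> n <= n' -> is_form L n p -> is_form L' n' p.
Proof.
  intros E H [W F]. split; [eapply fwf_extends; eauto|].
  intros x Hx. apply F in Hx. lia.
Qed.

Lemma tocc_rnt x t : tocc x (rnt t) = tocc x t.
Proof.
  induction t as [n|f ts IH] using term_ind_list; simpl; auto.
  induction IH; simpl; congruence.
Qed.

Lemma free_rn x p : free x (rn p) = free x p.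
Proof.
  induction p; simpl; rewrite ?tocc_rnt; try congruence.
  induction ts; simpl; rewrite ?tocc_rnt; congruence.
Qed.

Lemma twf_rnt L k t : twf L t = true -> twf (Lc L k) (rnt t) = true.
Proof.
  induction t as [n|f ts IH] using term_ind_list; auto.
  cbn [twf rnt]. rewrite fun_ar_Lc_old, length_map. intros H; bools; auto.
  rewrite forallb_forall in *. rewrite Forall_forall in IH.
  intros u Hu. apply in_map_iff in Hu as (v & <- & Hv). auto.
Qed.

Lemma fwf_rn L k p : fwf L p = true -> fwf (Lc L k) (rn p) = true.
Proof.
  induction p; cbn [fwf rn]; rewrite ?length_map; intros; bools; auto using twf_rnt.
  rewrite forallb_forall in *.
  intros u Hu. apply in_map_iff in Hu as (v & <- & Hv). auto using twf_rnt.
Qed.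

Lemma is_form_rn L k n p : is_form L n p -> is_form (Lc L k) n (rn p).
Proof.
  intros [W F]. split; [now apply fwf_rn|]. intros x. rewrite free_rn. apply F.
Qed.

(** Without constants the renaming is onto. This is what lets omega-saturation pass to the renamed
    language, where arbitrary formulas over [Lc L 0] have to be pulled back. *)
Lemma twf_Lc0_inv L t : twf (Lc L 0) t = true -> exists u, rnt u = t /\ twf L u = true.
Proof.
  induction t as [n|f ts IH] using term_ind_list; intros H.
  - now exists (Var n).
  - cbn [twf] in H. bools.
    assert (HU : exists us, map rnt us = ts /\ forallb (twf L) us = true).
    { clear H. induction IH as [|t ts Ht _ IHts].
      - now exists [].
      - simpl in H0. bools. destruct (Ht H) as (u & <- & Hu).
        destruct (IHts H0) as (us & <- & Hus). exists (u :: us). simpl. rewrite Hu. auto. }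
    destruct HU as (us & <- & Hus).
    rewrite length_map in H. apply ar_is_some in H. simpl in H.
    destruct (Nat.eqb_spec (pfst f) 0) as [E|E].
    + exists (App (psnd f) us). cbn [rnt twf]. split.
      * f_equal. rewrite <- E. apply cp_pfst_psnd.
      * bools; auto. now apply some_ar_is.
    + destruct (pfst f =? 1); discriminate.
Qed.

Lemma fwf_Lc0_inv L p : fwf (Lc L 0) p = true -> exists q, rn q = p /\ fwf L q = true.
Proof.
  induction p; cbn [fwf]; intros; bools.
  - now exists Fal.
  - apply twf_Lc0_inv in H as (a & <- & Ha), H0 as (b & <- & Hb).
    exists (Eqf a b). simpl. now rewrite Ha, Hb.
  - assert (HU : exists us, map rnt us = ts /\ forallb (twf L) us = true).
    { clear H. induction ts as [|t ts IHts].
      - now exists [].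
      - simpl in H0. bools. destruct (twf_Lc0_inv L t H) as (u & <- & Hu).
        destruct (IHts H0) as (us & <- & Hus). exists (u :: us). simpl. rewrite Hu. auto. }
    destruct HU as (us & <- & Hus). rewrite length_map in H.
    exists (Rel r us). cbn [rn fwf]. rewrite Hus. simpl in H. rewrite H. auto.
  - destruct (IHp H) as (q & <- & Hq). now exists (Neg q).
  - destruct (IHp1 H) as (q & <- & Hq). destruct (IHp2 H0) as (q' & <- & Hq').
    exists (Imp q q'). simpl. now rewrite Hq, Hq'.
  - destruct (IHp1 H) as (q & <- & Hq). destruct (IHp2 H0) as (q' & <- & Hq').
    exists (Conj q q'). simpl. now rewrite Hq, Hq'.
  - destruct (IHp1 H) as (q & <- & Hq). destruct (IHp2 H0) as (q' & <- & Hq').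
    exists (Disj q q'). simpl. now rewrite Hq, Hq'.
  - destruct (IHp H) as (q & <- & Hq). now exists (All x q).
  - destruct (IHp H) as (q & <- & Hq). now exists (Ex x q).
Qed.

Lemma is_form_Lc0_inv L n p : is_form (Lc L 0) n p -> exists q, rn q = p /\ is_form L n q.
Proof.
  intros [W F]. destruct (fwf_Lc0_inv L p W) as (q & <- & Hq). exists q.
  split; auto. split; auto. intros x Hx. apply F. now rewrite free_rn.
Qed.

(** A structure interprets every number at every list length, so agreement is asked only at declared
    arities. *)
Definition agree {A} (L : lang) (M N : structure A) : Prop :=
  (forall r l, rel_ar L r = Some (length l) -> (srel M r l <-> srel N r l)) /\
  (forall f l, fun_ar L f = Some (length l) -> sfun M f l = sfun N f l).

Lemma agree_refl {A} L (M : structure A) : agree L M M.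
Proof. split; intros; reflexivity. Qed.

Lemma teval_agree {A} L (M N : structure A) s s' t :
  agree L M N -> twf L t = true -> (forall x, tocc x t = true -> s x = s' x) ->
  teval M s t = teval N s' t.
Proof.
  intros [_ HF]. induction t as [n|f ts IH] using term_ind_list; simpl; intros W E.
  - apply E, Nat.eqb_refl.
  - bools.
    assert (Em : map (teval M s) ts = map (teval N s') ts).
    { apply map_ext_in. intros t Ht. rewrite Forall_forall in IH. apply IH; auto.
      - rewrite forallb_forall in H0; auto.
      - intros x Hx. apply E. eapply existsb_intro; eauto. }
    rewrite <- Em. apply HF. rewrite length_map. now apply ar_is_some.
Qed.

Lemma sat_agree {A} L (M N : structure A) p : agree L M N ->
  forall s s', fwf L p = true -> (forall x, free x p = true -> s x = s' x) ->
  (sat M s p <-> sat N s' p).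
Proof.
  intros HA. induction p; simpl; intros s s' W E; bools.
  - tauto.
  - rewrite (teval_agree L M N s s' t), (teval_agree L M N s s' u); auto; [tauto| |];
      intros x Hx; apply E; rewrite Hx; auto using orb_true_r.
  - assert (Em : map (teval M s) ts = map (teval N s') ts).
    { apply map_ext_in. intros t Ht. apply (teval_agree L); auto.
      - rewrite forallb_forall in H0; auto.
      - intros x Hx. apply E. eapply existsb_intro; eauto. }
    rewrite <- Em. apply HA. rewrite length_map. now apply ar_is_some.
  - now rewrite (IHp s s').
  - rewrite (IHp1 s s'), (IHp2 s s'); auto; [tauto| |];
      intros x Hx; apply E; rewrite Hx; auto using orb_true_r.
  - rewrite (IHp1 s s'), (IHp2 s s'); auto; [tauto| |];
      intros x Hx; apply E; rewrite Hx; auto using orb_true_r.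
  - rewrite (IHp1 s s'), (IHp2 s s'); auto; [tauto| |];
      intros x Hx; apply E; rewrite Hx; auto using orb_true_r.
  - assert (K : forall a, sat M (upd s x a) p <-> sat N (upd s' x a) p).
    { intros a. apply IHp; auto. intros y Hy. unfold upd.
      destruct (Nat.eqb_spec y x); auto. apply E. rewrite Hy.
      destruct (Nat.eqb_spec x y); simpl; congruence. }
    split; intros H a; apply K; auto.
  - assert (K : forall a, sat M (upd s x a) p <-> sat N (upd s' x a) p).
    { intros a. apply IHp; auto. intros y Hy. unfold upd.
      destruct (Nat.eqb_spec y x); auto. apply E. rewrite Hy.
      destruct (Nat.eqb_spec x y); simpl; congruence. }
    split; intros [a H]; exists a; apply K; auto.
Qed.

Lemma sat_is_form {A} L n (M : structure A) p s s' :
  is_form L n p -> (forall i, i < n -> s i = s' i) -> (sat M s p <-> sat M s' p).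
Proof.
  intros [W F] E. apply (sat_agree L); auto. apply agree_refl.
Qed.

Lemma teval_ext {A} (M : structure A) s s' t :
  (forall x, tocc x t = true -> s x = s' x) -> teval M s t = teval M s' t.
Proof.
  induction t as [n|f ts IH] using term_ind_list; simpl; intros E.
  - apply E, Nat.eqb_refl.
  - f_equal. apply map_ext_in. intros t Ht. rewrite Forall_forall in IH.
    apply IH; auto. intros x Hx. apply E. eapply existsb_intro; eauto.
Qed.

(* [dn N] reads the symbols of [N] through the renaming [rn]. *)
Definition dn {B} (N : structure B) : structure B :=
  Struct B (srel N) (fun f l => sfun N (cp 0 f) l).

Lemma teval_rnt {B} (N : structure B) s t : teval N s (rnt t) = teval (dn N) s t.
Proof.
  induction t as [n|f ts IH] using term_ind_list; simpl; auto.
  f_equal. rewrite map_map. apply map_ext_in. rewrite Forall_forall in IH. auto.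
Qed.

Lemma sat_rn {B} (N : structure B) p : forall s, sat N s (rn p) <-> sat (dn N) s p.
Proof.
  induction p; simpl; intros s.
  - tauto.
  - now rewrite !teval_rnt.
  - rewrite map_map. rewrite (map_ext _ _ (teval_rnt N s)). tauto.
  - now rewrite IHp.
  - now rewrite IHp1, IHp2.
  - now rewrite IHp1, IHp2.
  - now rewrite IHp1, IHp2.
  - split; intros H a; apply IHp, H.
  - split; intros [a H]; exists a; now apply IHp.
Qed.

(** * Substitution of constants and renaming of variables *)

Definition cN {B} (N : structure B) (i : nat) : B := sfun N (cp 1 i) [].

(* Substitution of [t] for [x] is expressed as [Ex x (x = t /\ p)], which is
   immune to capture and whose code is computed without a recursion on [p]. *)
Fixpoint gwrap (l : list (nat * term)) (p : form) : form :=
  match l with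
  | [] => p
  | (x, t) :: l' => Ex x (Conj (Eqf (Var x) t) (gwrap l' p))
  end.

Fixpoint asg {B} (N : structure B) (s : nat -> B) (l : list (nat * term)) : nat -> B :=
  match l with
  | [] => s
  | (x, t) :: l' => asg N (upd s x (teval N s t)) l'
  end.

Lemma upd_eq {B} (s : nat -> B) x a : upd s x a x = a.
Proof. unfold upd. now rewrite Nat.eqb_refl. Qed.

Lemma upd_neq {B} (s : nat -> B) x a y : y <> x -> upd s x a y = s y.
Proof. unfold upd. destruct (Nat.eqb_spec y x); congruence. Qed.

(** The quantifier on [x] also scopes over [t] in its own equation. As [x] does not occur in [t],
    the witness is forced to be the value of [t]. *)
Lemma sat_gwrap {B} (N : structure B) l p : forall s,
  (forall x t, In (x, t) l -> tocc x t = false) ->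
  (sat N s (gwrap l p) <-> sat N (asg N s l) p).
Proof.
  induction l as [|[x t] l IH]; intros s H; [simpl; tauto|].
  assert (K : forall a, teval N (upd s x a) t = teval N s t).
  { intros a. apply teval_ext. intros y Hy. apply upd_neq. intros ->.
    rewrite (H x t) in Hy; [discriminate|now left]. }
  assert (H' : forall y u, In (y, u) l -> tocc y u = false).
  { intros; apply H; now right. }
  simpl. split.
  - intros (a & E & S). rewrite upd_eq, K in E. subst a. now apply IH.
  - intros S. exists (teval N s t). rewrite upd_eq, K. split; auto. now apply IH.
Qed.

Lemma free_gwrap l p y : free y (gwrap l p) = true ->
  (exists x t, In (x, t) l /\ tocc y t = true) \/
  (free y p = true /\ forall x t, In (x, t) l -> x <> y).
Proof.
  induction l as [|[x t] l IH]; simpl; intros H.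
  - right. split; auto.
  - apply andb_true_iff in H as [H1 H2].
    destruct (Nat.eqb_spec x y) as [->|N]; [discriminate|]. cbn [orb] in H2.
    apply orb_true_iff in H2 as [H2|H2].
    + left. eauto 6.
    + destruct (IH H2) as [(x' & t' & I & O)|[F G]].
      * left. eauto 6.
      * right. split; auto. intros x' t' [E|I]; [congruence|eauto].
Qed.

Lemma fwf_gwrap L l p :
  (forall x t, In (x, t) l -> twf L t = true) -> fwf L p = true -> fwf L (gwrap l p) = true.
Proof.
  intros H W. induction l as [|[x t] l IH]; simpl; auto.
  bools; auto.
  - apply (H x t); now left.
  - apply IH. intros y u I. apply (H y u). now right.
Qed.

(** Plays the role of [p] with the constant of index [rho i] substituted for [x_i], for [i < m]. A
    map [rho] is needed because constants may be repeated and permuted. *)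
Definition Ws (rho : nat -> nat) (m : nat) (p : form) : form :=
  gwrap (map (fun i => (i, cst (rho i))) (seq 0 m)) p.

Lemma asg_cst {B} (N : structure B) rho m : forall a s i,
  asg N s (map (fun i => (i, cst (rho i))) (seq a m)) i =
  if (a <=? i) && (i <? a + m) then cN N (rho i) else s i.
Proof.
  induction m as [|m IH]; intros a s i; simpl.
  - destruct (Nat.leb_spec a i), (Nat.ltb_spec i (a + 0)); simpl; auto; lia.
  - rewrite IH. unfold upd.
    destruct (Nat.leb_spec a i), (Nat.ltb_spec i (a + S m)),
      (Nat.leb_spec (S a) i), (Nat.ltb_spec i (S a + m)), (Nat.eqb_spec i a);
      simpl; auto; try lia. subst. reflexivity.
Qed.

Lemma sat_Ws {B} (N : structure B) L rho m p s s' : is_form L m p ->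
  (forall i, i < m -> s' i = cN N (rho i)) -> (sat N s (Ws rho m p) <-> sat N s' p).
Proof.
  intros F E. unfold Ws. rewrite sat_gwrap.
  - apply (sat_is_form L m); auto. intros i Hi. rewrite asg_cst, E; auto.
    apply Nat.ltb_lt in Hi. simpl. now rewrite Hi.
  - intros x t I. apply in_map_iff in I as (i & E' & _). injection E' as <- <-. reflexivity.
Qed.

Lemma is_form_Ws L k rho m p : is_form (Lc L k) m p -> (forall i, i < m -> rho i < k) ->
  is_form (Lc L k) 0 (Ws rho m p).
Proof.
  intros [W F] R. split.
  - apply fwf_gwrap; auto. intros x t I.
    apply in_map_iff in I as (i & E & I). injection E as <- <-. apply in_seq in I.
    unfold cst. cbn [twf]. rewrite fun_ar_Lc_new; auto. apply R; lia.
  - intros y Hy. apply free_gwrap in Hy as [(x & t & I & O)|[Hy G]].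
    + apply in_map_iff in I as (i & E & I). injection E as <- <-. discriminate.
    + apply F in Hy. exfalso. apply (G y (cst (rho y))); auto.
      apply in_map_iff. exists y. split; auto. apply in_seq. lia.
Qed.

(** When sources and targets are disjoint, the successive assignments act as one simultaneous
    assignment. *)
Lemma asg_vars {B} (N : structure B) (f g : nat -> nat) m : forall a s i,
  (forall i j, f i = f j -> i = j) -> (forall i j, a <= i < a + m -> a <= j < a + m -> f i <> g j) ->
  (forall j, a <= j < a + m ->
     asg N s (map (fun i => (f i, Var (g i))) (seq a m)) (f j) = s (g j)) /\
  ((forall j, a <= j < a + m -> i <> f j) ->
     asg N s (map (fun i => (f i, Var (g i))) (seq a m)) i = s i).
Proof.
  induction m as [|m IH]; intros a s i Hf Hfg; simpl.
  - split; [intros; lia|auto].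
  - split.
    + intros j Hj. destruct (Nat.eq_dec j a) as [->|N0].
      * destruct (IH (S a) (upd s (f a) (s (g a))) (f a) Hf) as [_ K].
        { intros; apply Hfg; lia. }
        rewrite K; [apply upd_eq|]. intros j Hj' E. apply Hf in E. lia.
      * destruct (IH (S a) (upd s (f a) (s (g a))) i Hf) as [K _].
        { intros; apply Hfg; lia. }
        rewrite K by lia. apply upd_neq. intros E. symmetry in E. revert E. apply Hfg; lia.
    + intros Hi. destruct (IH (S a) (upd s (f a) (s (g a))) i Hf) as [_ K].
      { intros; apply Hfg; lia. }
      rewrite K; [|intros; apply Hi; lia]. apply upd_neq. apply Hi. lia.
Qed.

(* Simultaneous renaming: first copy [x_(rho i)] to a fresh [x_(k+m+i)], then
   [x_(k+m+i)] to [x_i]. *)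
Lemma rename_vars L m k rho p : is_form L m p -> (forall i, i < m -> rho i < k) ->
  exists q, is_form L k q /\
    forall A (M : structure A) s, sat M s q <-> sat M (fun i => s (rho i)) p.
Proof.
  intros [W F] R. set (K := k + m).
  set (l1 := map (fun i => (K + i, Var (rho i))) (seq 0 m)).
  set (l2 := map (fun i => (i, Var (K + i))) (seq 0 m)).
  assert (I1 : forall x t, In (x, t) l1 -> exists i, i < m /\ x = K + i /\ t = Var (rho i)).
  { intros x t I. apply in_map_iff in I as (i & E & I). injection E as <- <-.
    apply in_seq in I. exists i. repeat split; lia. }
  assert (I2 : forall x t, In (x, t) l2 -> exists i, i < m /\ x = i /\ t = Var (K + i)).
  { intros x t I. apply in_map_iff in I as (i & E & I). injection E as <- <-.
    apply in_seq in I. exists i. repeat split; lia. }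
  exists (gwrap l1 (gwrap l2 p)). split; [split|].
  - apply fwf_gwrap; [|apply fwf_gwrap; auto].
    + intros x t I. apply I1 in I as (i & _ & _ & ->). reflexivity.
    + intros x t I. apply I2 in I as (i & _ & _ & ->). reflexivity.
  - intros y Hy. apply free_gwrap in Hy as [(x & t & I & O)|[Hy G]].
    + apply I1 in I as (i & Hi & -> & ->). simpl in O. apply Nat.eqb_eq in O. subst y. auto.
    + apply free_gwrap in Hy as [(x & t & I & O)|[Hy G']].
      * apply I2 in I as (i & Hi & -> & ->). simpl in O. apply Nat.eqb_eq in O. subst y.
        exfalso. apply (G (K + i) (Var (rho i))); auto.
        apply in_map_iff. exists i. split; auto. apply in_seq; lia.
      * apply F in Hy. exfalso. apply (G' y (Var (K + y))); auto.
        apply in_map_iff. exists y. split; auto. apply in_seq; lia.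
  - intros A M s. rewrite !sat_gwrap.
    + apply (sat_is_form L m); [split; auto|]. intros i Hi.
      destruct (asg_vars M (fun i => i) (fun i => K + i) m 0 (asg M s l1) 0) as [E2 _];
        [auto|intros; unfold K; lia|].
      etransitivity; [apply (E2 i); lia|].
      destruct (asg_vars M (fun i => K + i) rho m 0 s 0) as [E1 _];
        [intros; lia|intros a b _ Hb; specialize (R b); unfold K; lia|].
      apply E1. lia.
    + intros x t I. apply I2 in I as (i & Hi & -> & ->). simpl. apply Nat.eqb_neq. unfold K. lia.
    + intros x t I. apply I1 in I as (i & Hi & -> & ->). simpl. apply Nat.eqb_neq.
      specialize (R i Hi). unfold K. lia.
Qed.

(** [scons] puts the new element at [x_0] and shifts the parameters up. To quantify it away, it is
    moved to the fresh index [k] and the parameters move down by one. *)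
Lemma exists_shift L k p : is_form L (S k) p ->
  exists q, is_form L k q /\
    forall A (M : structure A) s, sat M s q <-> exists b, sat M (scons b s) p.
Proof.
  intros F.
  destruct (rename_vars L (S k) (S k) (fun i => match i with 0 => k | S j => j end) p F)
    as (q & [Wq Fq] & E).
  { intros [|j]; lia. }
  exists (Ex k q). split.
  - split; auto. intros x Hx. simpl in Hx. apply andb_true_iff in Hx as [N Hx].
    apply Fq in Hx. destruct (Nat.eqb_spec k x); simpl in N; [discriminate|lia].
  - intros A M s. simpl.
    assert (K : forall b, sat M (upd s k b) q <-> sat M (scons b s) p).
    { intros b. rewrite E. apply (sat_is_form L (S k)); auto. intros [|i] Hi; simpl.
      - apply upd_eq.
      - apply upd_neq. lia. }
    split; intros [b H]; exists b; now apply K.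
Qed.

Definition conj_list (l : list form) : form := fold_right Conj (Neg Fal) l.

Lemma sat_conj_list {A} (M : structure A) s l :
  sat M s (conj_list l) <-> forall p, In p l -> sat M s p.
Proof.
  induction l as [|p l IH]; simpl.
  - split; [intros _ p []|auto].
  - rewrite IH. split.
    + intros [H K] q [<-|I]; auto.
    + intros H. split; [apply H|]; auto.
Qed.

Lemma is_form_conj_list L n l : (forall p, In p l -> is_form L n p) -> is_form L n (conj_list l).
Proof.
  induction l as [|p l IH]; intros H.
  - split; [reflexivity|discriminate].
  - destruct (H p) as [W F]; [now left|].
    destruct IH as [W' F']; [intros q Hq; apply H; now right|].
    split; simpl.
    + now rewrite W.
    + intros x Hx. apply orb_true_iff in Hx as [Hx|Hx]; auto.
Qed.

(** * Computability of the syntactic operations *)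

Definition term_step (m h : nat) : nat :=
  let p := psnd m in
  ifeq (pfst m) 0 m (cp 1 (cp (cp 0 (pfst p)) (pfst (psnd (lookup m h (psnd p)))))).

Definition list_step (m h : nat) : nat :=
  let p := pred m in
  ifeq m 0 0 (S (cp (pfst (lookup m h (pfst p))) (pfst (psnd (lookup m h (psnd p)))))).

(** The tests on [t] follow the tags of [enc]. In the last one, tags from 7 on are quantifiers,
    whose first component is a variable and is kept; the remaining tags 4 to 6 are the binary
    connectives. *)
Definition form_step (m h : nat) : nat :=
  let gt i := pfst (lookup m h i) in
  let gl i := pfst (psnd (lookup m h i)) in
  let gf i := psnd (psnd (lookup m h i)) in
  let t := pfst m in let p := psnd m in
  ifeq t 0 m
  (ifeq t 1 (cp 1 (cp (gt (pfst p)) (gt (psnd p))))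
  (ifeq t 2 (cp 2 (cp (pfst p) (gl (psnd p))))
  (ifeq t 3 (cp 3 (gf p))
  (ifz (7 - t) (cp t (cp (pfst p) (gf (psnd p))))
               (cp t (cp (gf (pfst p)) (gf (psnd p)))))))).

(* A number may be the code of a term, of a term list and of a formula; the
   recursion computes the codes of all three renamings together, as a triple. *)
Definition rstep (m h : nat) : nat := cp (term_step m h) (cp (list_step m h) (form_step m h)).

Definition RT (m : nat) := pfst (cov rstep m).
Definition RL (m : nat) := pfst (psnd (cov rstep m)).
Definition RE (m : nat) := psnd (psnd (cov rstep m)).

Lemma cmp_RE o : cmp o RE.
Proof.
  unfold RE. apply cmp_psnd, cmp_psnd, cmp_cov. unfold rstep, term_step, list_step, form_step. cbv zeta. cmp_auto.
Qed.

(** The positive tag makes the decrease strict, since [cp 0 0 = 0]. Recursive calls therefore find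
    their values in the history. *)
Lemma cp_args_lt x a b : a < cp (S x) (cp a b) /\ b < cp (S x) (cp a b).
Proof. pose proof (cp_ge (S x) (cp a b)). pose proof (cp_ge a b). lia. Qed.

Lemma RT_eq m : RT m = term_step m (hist rstep m).
Proof. unfold RT, cov. unfold rstep at 1. now rewrite pfst_cp. Qed.

Lemma RL_eq m : RL m = list_step m (hist rstep m).
Proof. unfold RL, cov. unfold rstep at 1. now rewrite psnd_cp, pfst_cp. Qed.

Lemma RE_eq m : RE m = form_step m (hist rstep m).
Proof. unfold RE, cov. unfold rstep at 1. now rewrite !psnd_cp. Qed.

Lemma RT_var n : RT (cp 0 n) = cp 0 n.
Proof. rewrite RT_eq; unfold term_step; rewrite pfst_cp. reflexivity. Qed.

Lemma RT_app f l : RT (cp 1 (cp f l)) = cp 1 (cp (cp 0 f) (RL l)).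
Proof.
  rewrite RT_eq. unfold term_step. rewrite !pfst_cp, !psnd_cp, pfst_cp, lookup_hist by apply cp_args_lt. reflexivity.
Qed.

Lemma RL_nil : RL 0 = 0.
Proof. rewrite RL_eq. reflexivity. Qed.

Lemma RL_cons a b : RL (S (cp a b)) = S (cp (RT a) (RL b)).
Proof.
  rewrite RL_eq. unfold list_step, ifeq. cbn [Nat.eqb pred]. rewrite pfst_cp, psnd_cp.
  pose proof (cp_ge a b). rewrite !lookup_hist by lia. reflexivity.
Qed.

Lemma RT_enc t : RT (enc_term t) = enc_term (rnt t).
Proof.
  induction t as [n|f ts IH] using term_ind_list; simpl.
  - apply RT_var.
  - rewrite RT_app. do 2 f_equal.
    induction IH as [|t ts Ht _ IH]; simpl; [apply RL_nil|].
    now rewrite RL_cons, Ht, IH.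
Qed.

Lemma RL_enc ts : RL (enc_terms ts) = enc_terms (map rnt ts).
Proof.
  induction ts as [|t ts IH]; simpl; [apply RL_nil|].
  now rewrite RL_cons, RT_enc, IH.
Qed.

Lemma RE_enc p : RE (enc p) = enc (rn p).
Proof.
  induction p as [|t u|r ts|p IHp|q IHq r IHr|q IHq r IHr|q IHq r IHr|x p IHp|x p IHp];
    simpl enc; rewrite RE_eq; unfold form_step; cbv zeta;
    rewrite ?pfst_cp, ?psnd_cp, ?pfst_cp; cbn [ifeq Nat.eqb ifz Nat.sub];
    rewrite ?lookup_hist by first [apply cp_args_lt | pose proof (cp_ge 3 (enc p)); lia];
    rewrite <- ?IHp, <- ?IHq, <- ?IHr, <- ?RT_enc, <- ?RL_enc; reflexivity.
Qed.

(** [8] and [5] are the tags of [Ex] and [Conj]. For a fixed list this is a finite composition of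
    pairings with constants, hence computable. *)
Fixpoint gcode (l : list (nat * term)) (e : nat) : nat :=
  match l with
  | [] => e
  | (x, t) :: l' => cp 8 (cp x (cp 5 (cp (enc (Eqf (Var x) t)) (gcode l' e))))
  end.

Lemma gcode_enc l p : gcode l (enc p) = enc (gwrap l p).
Proof. induction l as [|[x t] l IH]; simpl; congruence. Qed.

Lemma cmp_gcode o l f : cmp o f -> cmp o (fun x => gcode l (f x)).
Proof. intros H. induction l as [|[x t] l IH]; simpl; cmp_auto. Qed.

(** Codes do not shrink under the syntactic operations, so the preimages of a number are found by
    bounded search. *)
Lemma le_gwrap l p : enc p <= enc (gwrap l p).
Proof.
  induction l as [|[x t] l IH]; auto. cbn [gwrap].
  etransitivity; [exact IH|]. generalize (gwrap l p); intros q. cbn [enc].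
  generalize (cp 1 (cp (enc_term (Var x)) (enc_term t))); intros z.
  pose proof (cp_ge z (enc q)). pose proof (cp_ge 5 (cp z (enc q))).
  pose proof (cp_ge x (cp 5 (cp z (enc q)))).
  pose proof (cp_ge 8 (cp x (cp 5 (cp z (enc q))))). lia.
Qed.

Lemma le_enc_rnt t : enc_term t <= enc_term (rnt t).
Proof.
  induction t as [n|f ts IH] using term_ind_list; simpl; auto.
  apply cp_mono; auto. apply cp_mono; [pose proof (cp_ge 0 f); lia|].
  induction IH; simpl; auto. apply le_n_S, cp_mono; auto.
Qed.

Lemma le_enc_rn p : enc p <= enc (rn p).
Proof.
  induction p; simpl; repeat (apply cp_mono; auto using le_enc_rnt).
  induction ts; simpl; auto. apply le_n_S, cp_mono; auto using le_enc_rnt.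
Qed.

Definition wcode (rho : nat -> nat) (m e : nat) : nat :=
  gcode (map (fun i => (i, cst (rho i))) (seq 0 m)) (RE e).

Lemma wcode_enc rho m p : wcode rho m (enc p) = enc (Ws rho m (rn p)).
Proof. unfold wcode. now rewrite RE_enc, gcode_enc. Qed.

Lemma cmp_wcode o rho m : cmp o (wcode rho m).
Proof. apply cmp_gcode, cmp_RE. Qed.

Lemma le_enc_Ws rho m p : enc p <= enc (Ws rho m (rn p)).
Proof. etransitivity; [apply le_enc_rn|apply le_gwrap]. Qed.

(** Only preimages up to [n] are tried, which keeps the image decidable from [S] for computable [h].
    It is the full image whenever [m <= h m]. *)
Definition img (h : nat -> nat) (S : nat -> bool) (n : nat) : bool :=
  existsb (fun m => (h m =? n) && S m) (seq 0 (n + 1)).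

Lemma img_spec h S n : img h S n = true <-> exists m, m <= n /\ h m = n /\ S m = true.
Proof.
  unfold img. rewrite existsb_exists. split.
  - intros (m & I & H). apply in_seq in I. apply andb_true_iff in H as [H K].
    apply Nat.eqb_eq in H. exists m. repeat split; auto; lia.
  - intros (m & I & H & K). exists m. split; [apply in_seq; lia|].
    apply andb_true_iff. split; auto. now apply Nat.eqb_eq.
Qed.

Lemma chi_img h S n : chi (img h S) n =
  nat_rect (fun _ => nat) 0
    (fun i acc => ifeq (h i) n (ifz (chi S i) acc 1) acc) (n + 1).
Proof.
  unfold img, chi. generalize (n + 1) as k. induction k as [|k IH]; auto.
  rewrite seq_S, existsb_app. simpl. rewrite <- IH. unfold ifeq, ifz.
  destruct (existsb _ (seq 0 k)), (h k =? n), (S k); reflexivity.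
Qed.

(** * Closure properties of Scott sets *)

Section ScottClosure.
Variable X : (nat -> bool) -> Prop.
Hypothesis HX : scott X.

Lemma scott_reduct A B : X A -> cmp (chi A) (chi B) -> X B.
Proof. intros HA H. destruct HX as (_ & _ & _ & K & _). exact (K A B HA H). Qed.

Lemma scott_preimage A h : X A -> (forall o, cmp o h) -> X (fun n => A (h n)).
Proof.
  intros HA H. apply (scott_reduct A); auto. apply (cmp_orac (chi A) h (H _)).
Qed.

Lemma scott_img A h : X A -> (forall o, cmp o h) -> X (img h A).
Proof.
  intros HA H. apply (scott_reduct A); auto.
  eapply cmp_ext; [intros n; symmetry; apply chi_img|].
  apply (cmp_rec _ (fun _ => 0) (fun n => n + 1)
    (fun i acc n => ifeq (h i) n (ifz (chi A i) acc 1) acc)).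
  - cmp_auto.
  - apply (cmp_ext _ (fun n => S n)); [intros; lia|cmp_auto].
  - assert (cmp (chi A) (fun z => h (pfst z))) by (apply cmp_comp; [apply H|cmp_auto]).
    assert (cmp (chi A) (fun z => chi A (pfst z))) by (apply cmp_orac; cmp_auto).
    cmp_auto.
Qed.

Lemma scott_or A B : X A -> X B -> X (fun n => A n || B n).
Proof. destruct HX as (_ & K & _). apply K. Qed.

Lemma scott_ext A B : X A -> (forall n, A n = B n) -> X B.
Proof.
  intros HA E. apply (scott_reduct A); auto.
  apply (cmp_ext _ (fun n => chi A n)); [|apply cmp_orac, cmp_id].
  intros n. unfold chi. now rewrite E.
Qed.

Lemma scott_and A B : X A -> X B -> X (fun n => A n && B n).
Proof.
  intros HA HB. destruct HX as (_ & _ & N & _).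
  apply (scott_ext (fun n => negb (negb (A n) || negb (B n)))).
  - apply N, scott_or; now apply N.
  - intros n. now destruct (A n), (B n).
Qed.

Lemma scott_single c : X (fun n => n =? c).
Proof.
  destruct HX as ((A & HA) & _). apply (scott_reduct A); auto.
  apply (cmp_ext _ (fun n => ifeq n c 1 0)); [|cmp_auto].
  intros n. unfold chi, ifeq. reflexivity.
Qed.

End ScottClosure.

Lemma img_wcode_spec rho m S n :
  (forall c, S c = true -> exists q, enc q = c) ->
  (img (wcode rho m) S n = true <-> exists q, mem S q /\ n = enc (Ws rho m (rn q))).
Proof.
  intros HS. rewrite img_spec. split.
  - intros (c & _ & E & H). destruct (HS c H) as [q <-]. exists q. split; auto.
    now rewrite wcode_enc in E.
  - intros (q & H & ->). exists (enc q). repeat split; auto.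
    + apply le_enc_Ws.
    + apply wcode_enc.
Qed.

Lemma mem_img_wcode rho m S p :
  (forall c, S c = true -> exists q, enc q = c) ->
  (mem (img (wcode rho m) S) p <-> exists q, mem S q /\ p = Ws rho m (rn q)).
Proof.
  intros HS. unfold mem at 1. rewrite img_wcode_spec; auto.
  split; intros (q & H & E); exists q; split; auto.
  - now apply enc_inj.
  - now rewrite E.
Qed.

(** * Types and strong homogeneity *)

(** Dependent choice with one requirement per step; it drives both the back-and-forth and the Henkin
    construction. *)
Lemma chain_exists (St : Type) (le : St -> St -> Prop) (D : nat -> St -> Prop) :
  (forall s, le s s) -> (forall s t u, le s t -> le t u -> le s u) ->
  (forall i s, exists t, le s t /\ D i t) ->
  forall s0, exists c : nat -> St, c 0 = s0 /\ (forall i j, i <= j -> le (c i) (c j)) /\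
    forall i, D i (c (S i)).
Proof.
  intros Hr Ht HD s0.
  set (next := fun i s => proj1_sig (constructive_indefinite_description _ (HD i s))).
  assert (Hn : forall i s, le s (next i s) /\ D i (next i s)).
  { intros i s. unfold next. apply proj2_sig. }
  set (c := nat_rect (fun _ => St) s0 next).
  exists c. split; [reflexivity|split].
  - intros i j H. induction H as [|j _ IH]; auto. eapply Ht; [exact IH|apply Hn].
  - intros i. apply Hn.
Qed.

(** Sets of formulas are boolean functions, so a set defined by truth in a structure has to be
    turned into one by excluded middle. *)
Definition truth (Q : nat -> Prop) (n : nat) : bool :=
  if excluded_middle_informative (Q n) then true else false.

Lemma truth_spec Q n : truth Q n = true <-> Q n.
Proof. unfold truth. destruct (excluded_middle_informative (Q n)); split; auto; discriminate. Qed.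

Definition tp {A} (L : lang) (M : structure A) (k : nat) (s : nat -> A) : nat -> bool :=
  truth (fun n => exists p, enc p = n /\ is_form L k p /\ sat M s p).

Lemma mem_tp {A} L (M : structure A) k s p : mem (tp L M k s) p <-> is_form L k p /\ sat M s p.
Proof.
  unfold mem, tp. rewrite truth_spec. split.
  - intros (q & E & H). apply enc_inj in E. now subst.
  - intros H. exists p. auto.
Qed.

Lemma tp_code {A} L (M : structure A) k s n :
  tp L M k s n = true -> exists p, enc p = n /\ is_form L k p.
Proof.
  unfold tp. rewrite truth_spec. intros (p & E & F & _). eauto.
Qed.

(** The whole tuple is taken as parameters and no variable is left, so the type is trivially
    realized and X-saturation puts it in [X]. The case [k = 0] yields the theory of [M]. *)
Lemma tp_in_X {A} L X (M : structure A) k s :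
  scott X -> X_saturated L X M -> X (tp L M k s).
Proof.
  intros HX HM.
  assert (E : forall i, join 0 s s i = s i).
  { intros i. unfold join. cbn. now rewrite Nat.sub_0_r. }
  assert (R : forall p, mem (tp L M k s) p -> sat M (join 0 s s) p).
  { intros p H. apply mem_tp in H as [F H]. revert H. apply (sat_is_form L k); auto. }
  apply (HM 0 k s); [|now exists s].
  split; [|split].
  - intros n Hn. now apply tp_code in Hn.
  - intros l Hl. exists s. auto.
  - intros p F. rewrite !mem_tp. destruct (classic (sat M s p)); [now left|right].
    split; auto.
Qed.

Lemma realize_in_X {A} L X (M : structure A) k (v : nat -> A) (Q : nat -> bool) :
  X_saturated L X M -> X Q ->
  type_in L (S k) Q -> (forall p, is_form L (S k) p -> mem Q p \/ mem Q (Neg p)) ->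
  (forall l, (forall p, In p l -> mem Q p) -> exists b, forall p, In p l -> sat M (scons b v) p) ->
  exists b, forall p, mem Q p -> sat M (scons b v) p.
Proof.
  intros HM HQ HT HC HF.
  assert (E : forall (b : nat -> A) p, mem Q p ->
    (sat M (join 1 b v) p <-> sat M (scons (b 0) v) p)).
  { intros b p Hp. destruct (HT _ Hp) as (q & Eq & F). apply enc_inj in Eq. subst q.
    apply (sat_is_form L (S k)); auto. intros [|i] Hi; auto.
    unfold join. cbn. now rewrite Nat.sub_0_r. }
  destruct (HM 1 k v Q) as [_ HR].
  - split; [exact HT|split; [|exact HC]].
    intros l Hl. destruct (HF l Hl) as [b Hb]. exists (fun _ => b). intros p Hp.
    apply E; auto.
  - destruct (HR HQ) as [b Hb]. exists (b 0). intros p Hp. apply E; auto.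
Qed.

Definition same_type {A} (L : lang) (M : structure A) (k : nat) (u v : nat -> A) : Prop :=
  forall p, is_form L k p -> (sat M u p <-> sat M v p).

Lemma same_type_extend {A} L X (M : structure A) k u v c :
  scott X -> X_saturated L X M -> same_type L M k u v ->
  exists d, same_type L M (S k) (scons c u) (scons d v).
Proof.
  intros HX HM S.
  destruct (realize_in_X L X M k v (tp L M (Datatypes.S k) (scons c u))) as [d Hd]; auto.
  - now apply tp_in_X.
  - intros n. apply tp_code.
  - intros p F. rewrite !mem_tp. destruct (classic (sat M (scons c u) p)); [now left|right].
    split; auto.
  - intros l Hl.
    (* The existential closure of the conjunction speaks of [u] alone, so it transfers to [v]. *)
    destruct (exists_shift L k (conj_list l)) as (q & Fq & Eq).
    { apply is_form_conj_list. intros p Hp. apply Hl in Hp. now apply mem_tp in Hp. }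
    assert (H : sat M v q).
    { apply S; auto. apply Eq. exists c. apply sat_conj_list.
      intros p Hp. apply Hl in Hp. now apply mem_tp in Hp. }
    apply Eq in H as [b Hb]. exists b. now apply sat_conj_list.
  - exists d. intros p F. split; intros H.
    + apply Hd. now apply mem_tp.
    + apply NNPP. intros N. apply (Hd (Neg p)); auto. now apply mem_tp.
Qed.

(** * Finite partial elementary maps and the back-and-forth *)

Section BackAndForth.
Context {A : Type} (L : lang) (M : structure A) (d0 : A).

(** New pairs are added at the head, which matches the shift of indices made by [scons]. *)
Definition lft (l : list (A * A)) (i : nat) : A := fst (nth i l (d0, d0)).
Definition rgt (l : list (A * A)) (i : nat) : A := snd (nth i l (d0, d0)).
Definition partial_elementary (l : list (A * A)) : Prop :=
  same_type L M (length l) (lft l) (rgt l).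

Lemma In_index l x y : In (x, y) l -> exists i, i < length l /\ lft l i = x /\ rgt l i = y.
Proof.
  intros H. destruct (In_nth l (x, y) (d0, d0) H) as (i & Hi & E).
  exists i. unfold lft, rgt. rewrite E. auto.
Qed.

(** Preserving [x_i = x_j] in both directions makes the union of the maps functional and
    injective. *)
Lemma partial_elementary_eq l x y x' y' : partial_elementary l ->
  In (x, y) l -> In (x', y') l -> (x = x' <-> y = y').
Proof.
  intros H I I'. apply In_index in I as (i & Hi & <- & <-).
  apply In_index in I' as (j & Hj & <- & <-).
  apply (H (Eqf (Var i) (Var j))). split; [reflexivity|].
  intros x Hx. simpl in Hx. apply orb_true_iff in Hx as [Hx|Hx];
    apply Nat.eqb_eq in Hx; lia.
Qed.

Lemma indices l (f : A -> A) xs : (forall x, In x xs -> In (x, f x) l) ->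
  exists js, map (lft l) js = xs /\ map (rgt l) js = map f xs /\
    forall j, In j js -> j < length l.
Proof.
  induction xs as [|x xs IH]; intros H.
  - exists []. simpl. repeat split. intros _ [].
  - destruct IH as (js & E & E' & B); [intros; apply H; now right|].
    destruct (In_index l x (f x)) as (i & Hi & Ei & Ei'); [apply H; now left|].
    exists (i :: js). simpl. rewrite Ei, Ei', E, E'. repeat split.
    intros j [<-|Hj]; auto.
Qed.

Lemma tocc_vars x js : existsb (tocc x) (map Var js) = true -> In x js.
Proof.
  rewrite existsb_exists. intros (t & I & H). apply in_map_iff in I as (j & <- & I).
  simpl in H. apply Nat.eqb_eq in H. now subst.
Qed.

Lemma twf_vars js : forallb (twf L) (map Var js) = true.
Proof. induction js; auto. Qed.

Lemma partial_elementary_rel l f r xs : partial_elementary l ->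
  rel_ar L r = Some (length xs) -> (forall x, In x xs -> In (x, f x) l) ->
  (srel M r xs <-> srel M r (map f xs)).
Proof.
  intros H R I. destruct (indices l f xs I) as (js & E & E' & B).
  pose proof (H (Rel r (map Var js))) as K. simpl in K.
  rewrite !map_map in K. simpl in K.
  change (is_form L (length l) (Rel r (map Var js)) ->
    (srel M r (map (lft l) js) <-> srel M r (map (rgt l) js))) in K.
  rewrite E, E' in K. apply K. split.
  - cbn [fwf]. rewrite twf_vars, length_map. rewrite <- E, length_map in R.
    now rewrite (some_ar_is _ _ R).
  - intros x Hx. apply B, tocc_vars, Hx.
Qed.

(** The operation is seen only through the formula for its graph, so the pair at the value
    [sfun M h xs] must itself belong to [l]. *)
Lemma partial_elementary_fun l f h xs : partial_elementary l ->
  fun_ar L h = Some (length xs) -> (forall x, In x xs -> In (x, f x) l) ->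
  In (sfun M h xs, f (sfun M h xs)) l -> f (sfun M h xs) = sfun M h (map f xs).
Proof.
  intros H R I I'. destruct (indices l f xs I) as (js & E & E' & B).
  destruct (In_index l _ _ I') as (i & Hi & Ei & Ei').
  pose proof (H (Eqf (App h (map Var js)) (Var i))) as K. simpl in K.
  rewrite !map_map in K. simpl in K.
  change (is_form L (length l) (Eqf (App h (map Var js)) (Var i)) ->
    (sfun M h (map (lft l) js) = lft l i <-> sfun M h (map (rgt l) js) = rgt l i)) in K.
  rewrite E, E', Ei, Ei' in K. symmetry. apply K; auto. split.
  - cbn [fwf twf]. rewrite twf_vars, length_map. rewrite <- E, length_map in R.
    now rewrite (some_ar_is _ _ R).
  - intros x Hx. cbn [free tocc] in Hx. apply orb_true_iff in Hx as [Hx|Hx].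
    + apply B, tocc_vars, Hx.
    + apply Nat.eqb_eq in Hx. lia.
Qed.

Lemma partial_elementary_cons X l c : scott X -> X_saturated L X M ->
  partial_elementary l -> exists d, partial_elementary ((c, d) :: l).
Proof.
  intros HX HM H. destruct (same_type_extend L X M _ _ _ c HX HM H) as [d Hd].
  exists d. intros p F. specialize (Hd p F).
  rewrite (sat_is_form L _ M p (lft ((c, d) :: l)) (scons c (lft l)) F);
    [|intros [|i] _; reflexivity].
  rewrite (sat_is_form L _ M p (rgt ((c, d) :: l)) (scons d (rgt l)) F);
    [exact Hd|intros [|i] _; reflexivity].
Qed.

Lemma partial_elementary_cons_r X l c : scott X -> X_saturated L X M ->
  partial_elementary l -> exists d, partial_elementary ((d, c) :: l).
Proof.
  intros HX HM H.
  destruct (same_type_extend L X M (length l) (rgt l) (lft l) c HX HM) as [d Hd].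
  { intros p F. symmetry. now apply H. }
  exists d. intros p F. specialize (Hd p F).
  rewrite (sat_is_form L _ M p (lft ((d, c) :: l)) (scons d (lft l)) F);
    [|intros [|i] _; reflexivity].
  rewrite (sat_is_form L _ M p (rgt ((d, c) :: l)) (scons c (rgt l)) F);
    [symmetry; exact Hd|intros [|i] _; reflexivity].
Qed.

End BackAndForth.

Theorem X_saturated_strongly_homogeneous {A} L X (M : structure A) :
  countable A -> scott X -> X_saturated L X M -> strongly_homogeneous L M.
Proof.
  intros [code Hcode] HX HM n a b Hab.
  set (d0 := a 0). set (PE := partial_elementary L M d0).
  set (l0 := map (fun i => (a i, b i)) (seq 0 n)).
  assert (H0 : PE l0).
  { intros p F. unfold l0 in F. rewrite length_map, length_seq in F.
    assert (E : forall i, i < n -> nth i l0 (d0, d0) = (a i, b i)).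
    { intros i Hi. unfold l0.
      rewrite (nth_indep _ _ ((fun i => (a i, b i)) 0)) by now rewrite length_map, length_seq.
      rewrite (map_nth (fun i => (a i, b i))), seq_nth; auto. }
    rewrite (sat_is_form L n M p (lft d0 l0) a F), (sat_is_form L n M p (rgt d0 l0) b F); auto;
      intros i Hi; unfold lft, rgt; now rewrite E. }
  (* As [code] is injective, requirement [i] concerns at most one element, which has to enter both
     the domain and the range. *)
  set (D := fun i (l : {l | PE l}) => forall x, code x = i ->
    (exists y, In (x, y) (proj1_sig l)) /\ (exists y, In (y, x) (proj1_sig l))).
  destruct (chain_exists {l | PE l} (fun l l' => incl (proj1_sig l) (proj1_sig l')) D)
    with (s0 := exist PE l0 H0) as (c & C0 & Cm & CD).
  - intros s. apply incl_refl.
  - intros s t u. apply incl_tran.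
  - intros i [l Hl]. destruct (classic (exists x, code x = i)) as [[x Ex]|N].
    + destruct (partial_elementary_cons L M d0 X l x HX HM Hl) as [y Hy].
      destruct (partial_elementary_cons_r L M d0 X _ x HX HM Hy) as [z Hz].
      exists (exist PE _ Hz). simpl. split.
      * intros w Hw. now do 2 right.
      * intros x' Ex'. assert (x' = x) as -> by (apply Hcode; congruence). simpl. split; eauto.
    + exists (exist PE l Hl). split; [apply incl_refl|]. intros x Ex. exfalso; eauto.
  - set (R := fun x y => exists t, In (x, y) (proj1_sig (c t))).
    assert (RR : forall x y x' y', R x y -> R x' y' -> (x = x' <-> y = y')).
    { intros x y x' y' [t I] [t' I'].
      apply (partial_elementary_eq L M d0 (proj1_sig (c (max t t')))).
      - apply (proj2_sig (c (max t t'))).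
      - apply (Cm t); [lia|exact I].
      - apply (Cm t'); [lia|exact I']. }
    assert (Rl : forall x, exists y, R x y).
    { intros x. destruct (CD (code x) x eq_refl) as [[y Hy] _]. exists y. now exists (S (code x)). }
    assert (Rr : forall y, exists x, R x y).
    { intros y. destruct (CD (code y) y eq_refl) as [_ [x Hx]]. exists x. now exists (S (code y)). }
    set (f := fun x => proj1_sig (constructive_indefinite_description _ (Rl x))).
    set (g := fun y => proj1_sig (constructive_indefinite_description _ (Rr y))).
    assert (Hf : forall x, R x (f x)) by (intros x; unfold f; apply proj2_sig).
    assert (Hg : forall y, R (g y) y) by (intros y; unfold g; apply proj2_sig).
    (* Preservation of one symbol involves finitely many elements, so a single map of the chain
       contains all the pairs needed. *)
    assert (Hs : forall xs, exists t, forall x, In x xs -> In (x, f x) (proj1_sig (c t))).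
    { induction xs as [|x xs [t IH]].
      - exists 0. intros _ [].
      - destruct (Hf x) as [t' I]. exists (max t t'). intros y [<-|Hy].
        + apply (Cm t'); [lia|exact I].
        + apply (Cm t); [lia|auto]. }
    exists f. split; [split; [|split]|].
    + exists g. split.
      * intros x. apply (RR _ (f x) x (f x)); auto.
      * intros y. apply (RR (g y) _ (g y) y); auto.
    + intros r m xs Hr Hl. destruct (Hs xs) as [t Ht].
      apply (partial_elementary_rel L M d0 (proj1_sig (c t))); auto.
      * apply (proj2_sig (c t)).
      * congruence.
    + intros h m xs Hh Hl. destruct (Hs (sfun M h xs :: xs)) as [t Ht].
      apply (partial_elementary_fun L M d0 (proj1_sig (c t))).
      * apply (proj2_sig (c t)).
      * congruence.
      * intros; apply Ht; now right.
      * apply Ht; now left.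
    + intros i Hi. apply (RR (a i) _ (a i) (b i)); auto.
      exists 0. rewrite C0. simpl. unfold l0. apply in_map_iff. exists i.
      split; auto. apply in_seq. lia.
Qed.

(** * The stages of the Henkin construction *)

(** The symbol [cp 1 k] is not in [Lc L k], so a new constant can receive any value without changing
    the truth of earlier formulas. *)
Definition setc {B} (N : structure B) (k : nat) (b : B) : structure B :=
  Struct B (srel N) (fun f l => if f =? cp 1 k then b else sfun N f l).

Lemma agree_setc {B} L k (N : structure B) b : agree (Lc L k) N (setc N k b).
Proof.
  split; simpl; [tauto|]. intros f l H.
  destruct (Nat.eqb_spec f (cp 1 k)) as [->|]; auto.
  rewrite pfst_cp, psnd_cp, Nat.ltb_irrefl in H. discriminate.
Qed.

Lemma cN_setc_same {B} (N : structure B) k b : cN (setc N k b) k = b.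
Proof. unfold cN. simpl. now rewrite Nat.eqb_refl. Qed.

Lemma cN_setc_other {B} (N : structure B) k b i : i <> k -> cN (setc N k b) i = cN N i.
Proof.
  intros H. unfold cN. simpl. destruct (Nat.eqb_spec (cp 1 i) (cp 1 k)) as [E|]; auto.
  apply cp_inj in E as [_ E]. contradiction.
Qed.

(** Saturation puts the new element at [x_0], the stages put it at [x_k]; this passes between the
    two conventions. *)
Lemma rotate_vars L k p : is_form L (S k) p ->
  exists q, is_form L (S k) q /\
    forall B (N : structure B) s b, sat N (scons b s) q <-> sat N (upd s k b) p.
Proof.
  intros F.
  destruct (rename_vars L (S k) (S k) (fun i => if i =? k then 0 else S i) p F)
    as (q & Fq & E).
  { intros i Hi. destruct (Nat.eqb_spec i k); lia. }
  exists q. split; auto. intros B N s b. rewrite E. apply (sat_is_form L (S k)); auto.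
  intros i Hi. unfold upd. destruct (Nat.eqb_spec i k); reflexivity.
Qed.

Lemma theory_mono L L' T : extends L L' -> theory L T -> theory L' T.
Proof.
  intros E H k Hk. destruct (H k Hk) as (p & Ep & F). exists p. split; auto.
  eapply is_form_extends; eauto.
Qed.

Lemma theory_mem L T p : theory L T -> mem T p -> is_form L 0 p.
Proof. intros H Hp. destruct (H _ Hp) as (q & E & F). apply enc_inj in E. now subst. Qed.

Lemma type_in_mem L n T p : type_in L n T -> mem T p -> is_form L n p.
Proof. intros H Hp. destruct (H _ Hp) as (q & E & F). apply enc_inj in E. now subst. Qed.

Lemma is_form_Ex L m x p : is_form L m p -> is_form L m (Ex x p).
Proof.
  intros [W F]. split; auto. intros y Hy. simpl in Hy. apply andb_true_iff in Hy as [_ Hy]. auto.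
Qed.

(* A complete theory decides [Ws rho m p], so any model of it computes membership. *)
Lemma mem_Ws {B} L k T (N : structure B) rho m p s :
  complete (Lc L k) T -> models N T -> is_form (Lc L k) m p ->
  (forall i, i < m -> rho i < k) -> (forall i, i < m -> s i = cN N (rho i)) ->
  (mem T (Ws rho m p) <-> sat N s p).
Proof.
  intros HC HN F R E. split; intros H.
  - apply (sat_Ws N (Lc L k) rho m p s s F E). now apply HN.
  - destruct (HC (Ws rho m p)) as [|K]; auto.
    + now apply is_form_Ws.
    + exfalso. apply (HN _ K s). now apply (sat_Ws N (Lc L k) rho m p s s F E).
Qed.

Definition sub (T T' : nat -> bool) : Prop := forall n, T n = true -> T' n = true.

Section Stages.
Context {A : Type} (L L' : lang) (M : structure A) (X : (nat -> bool) -> Prop)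
  (T0 P' : nat -> bool) (n : nat).
Hypothesis HL : recursive_lang L.
Hypothesis HL' : recursive_lang L'.
Hypothesis HLL' : extends L L'.
Hypothesis HX : Con_sat_closed X.
Hypothesis HM : X_saturated L X M.
Hypothesis HT0 : theory (Lc L 0) T0.
Hypothesis XT0 : X T0.
Hypothesis HP' : type_in (Lc L' 0) n P'.
Hypothesis XP' : X P'.

Let Hscott : scott X := proj1 HX.

(** The content of [Con_sat] for one given model, isolated because that model is reused after one
    constant has been reinterpreted. *)
Definition witness {B} (N : structure B) (T : nat -> bool) : Prop :=
  (forall p, mem T0 p -> forall s, sat N s p) /\ models N T /\
  omits N P' /\ omega_saturated (Lc L 0) N.

(* [T] describes the expansion being built, with [c_i] naming [e i] for [i < k]. *)
Definition stage (k : nat) (e : nat -> A) (T : nat -> bool) : Prop :=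
  X T /\ theory (Lc L' k) T /\ complete (Lc L' k) T /\
  Con_sat (Lc L 0) (mem T0) T P' /\
  (forall p, is_form L k p -> sat M e p -> mem T (Ws (fun i => i) k (rn p))).

(** [T0], [P'] and the saturation condition live over languages without constants, and [T] over
    [Lc L' k], so a change outside [Lc L' k] disturbs none of them. *)
Lemma witness_agree {B} (N N' : structure B) k T :
  agree (Lc L' k) N N' -> theory (Lc L' k) T -> witness N T -> witness N' T.
Proof.
  intros HA HT (W1 & W2 & W3 & W4).
  assert (K : forall m p s, is_form (Lc L' k) m p -> (sat N s p <-> sat N' s p)).
  { intros m p s [W F]. apply (sat_agree (Lc L' k)); auto. }
  assert (E : extends (Lc L 0) (Lc L' k)) by (apply extends_Lc; auto; lia).
  repeat split.
  - intros p Hp s. apply (K 0); [|auto].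
    eapply is_form_extends; [exact E|apply le_n|]. eapply theory_mem; eauto.
  - intros p Hp s. apply (K 0); [|auto]. eapply theory_mem; eauto.
  - intros s. destruct (W3 s) as (p & Hp & S). exists p. split; auto.
    rewrite <- (K n); auto. eapply is_form_extends; [|apply le_n|eapply type_in_mem; eauto].
    apply extends_Lc; [apply extends_refl|lia].
  - intros j a q Hq Hfin.
    assert (K' : forall p b, q p -> (sat N (scons b a) p <-> sat N' (scons b a) p)).
    { intros p b Hp. apply (K (S j)). eapply is_form_extends; [exact E|apply le_n|auto]. }
    destruct (W4 j a q Hq) as [b Hb].
    + intros l Hl. destruct (Hfin l Hl) as [b Hb]. exists b. intros p Hp. apply K'; auto.
    + exists b. intros p Hp. apply K'; auto.
Qed.

(** Closedness of [X] is applied with the base language fixed at [Lc L 0]; only the extension grows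
    with [k]. *)
Lemma complete_extension k T : X T -> theory (Lc L' k) T ->
  Con_sat (Lc L 0) (mem T0) T P' ->
  exists T', X T' /\ theory (Lc L' k) T' /\ complete (Lc L' k) T' /\ sub T T' /\
    Con_sat (Lc L 0) (mem T0) T' P'.
Proof.
  intros HT Hth HC. pose proof (proj2 HX) as K.
  apply (K (Lc L 0) (Lc L' k) T0 T n P'); auto using recursive_Lc.
  - apply extends_Lc; auto; lia.
  - intros c Hc. destruct (HP' c Hc) as (p & E & F). exists p. split; auto.
    eapply is_form_extends; [|apply le_n|exact F]. apply extends_Lc; [apply extends_refl|lia].
Qed.

Lemma models_union {B} (N : structure B) T U :
  models N T -> models N U -> models N (fun c => T c || U c).
Proof. intros H K p Hp s. apply orb_true_iff in Hp as [Hp|Hp]; [now apply H|now apply K]. Qed.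

Lemma theory_union K T U : theory K T -> theory K U -> theory K (fun c => T c || U c).
Proof. intros H H' c Hc. apply orb_true_iff in Hc as [Hc|Hc]; auto. Qed.

Lemma extends_Lc_S k : extends (Lc L' k) (Lc L' (S k)).
Proof. apply extends_Lc; [apply extends_refl|lia]. Qed.

Lemma theory_img_tp k (s : nat -> A) :
  theory (Lc L' k) (img (wcode (fun i => i) k) (tp L M k s)).
Proof.
  intros c Hc. apply img_wcode_spec in Hc as (q & Hq & ->).
  - exists (Ws (fun i => i) k (rn q)). split; auto. apply mem_tp in Hq as [F _].
    apply is_form_Ws; auto. apply is_form_rn. eapply is_form_extends; eauto.
  - intros d Hd. apply tp_code in Hd as (p & E & _). eauto.
Qed.

Lemma mem_img_tp k (s : nat -> A) p :
  mem (img (wcode (fun i => i) k) (tp L M k s)) p <->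
  exists q, (is_form L k q /\ sat M s q) /\ p = Ws (fun i => i) k (rn q).
Proof.
  rewrite mem_img_wcode.
  - split; intros (q & H & E); exists q; (split; [|exact E]); now apply mem_tp.
  - intros d Hd. apply tp_code in Hd as (q & E & _). eauto.
Qed.

Lemma stage_realize {B} (N : structure B) k e T a :
  stage k e T -> witness N T ->
  exists b, forall p, is_form L (S k) p -> sat M (scons a e) p -> sat (dn N) (scons b (cN N)) p.
Proof.
  intros (_ & Hth & Hc & _ & Htp) (_ & WN & _ & Hsat).
  destruct (Hsat k (cN N)
    (fun p => exists q, p = rn q /\ is_form L (S k) q /\ sat M (scons a e) q)) as [b Hb].
  - intros p (q & -> & F & _). now apply is_form_rn.
  - intros l Hl.
    assert (Hfs : exists fs, l = map rn fs /\
      forall q, In q fs -> is_form L (S k) q /\ sat M (scons a e) q).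
    { induction l as [|p l IH].
      - exists []. split; auto. intros q [].
      - destruct IH as (fs & E & Hfs); [intros; apply Hl; now right|].
        destruct (Hl p) as (q & -> & Hq); [now left|].
        exists (q :: fs). simpl. split; [congruence|]. intros r [<-|Hr]; auto. }
    destruct Hfs as (fs & -> & Hfs).
    destruct (exists_shift L k (conj_list fs)) as (q & Fq & Eq).
    { apply is_form_conj_list. intros p Hp. now apply Hfs. }
    (* The existential closure holds of [e] in [M], so the type clause of [stage] makes it a
       sentence of [T]. *)
    assert (H : sat (dn N) (cN N) q).
    { apply sat_rn. apply (mem_Ws L' k T N (fun i => i) k); auto.
      - apply is_form_rn. eapply is_form_extends; eauto.
      - apply Htp; auto. apply Eq. exists a. apply sat_conj_list. intros p Hp. now apply Hfs. }
    apply Eq in H as [b Hb]. exists b. intros p Hp.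
    apply in_map_iff in Hp as (r & <- & Hr). apply sat_rn.
    revert r Hr. now apply sat_conj_list.
  - exists b. intros p F H. apply sat_rn. apply Hb. eauto.
Qed.

Lemma stage_add k e T a : stage k e T ->
  exists T', stage (S k) (upd e k a) T' /\ sub T T'.
Proof.
  intros Hst. pose proof Hst as (HT & Hth & Hc & (B & N & HB & HN) & Htp).
  fold (witness N T) in HN.
  (* The [L]-type of the enlarged tuple is added before completing, so that the type clause of
     [stage] holds again. *)
  set (U := img (wcode (fun i => i) (S k)) (tp L M (S k) (upd e k a))).
  destruct (complete_extension (S k) (fun c => T c || U c)) as (T' & XT' & H1 & H2 & H3 & H4).
  - apply scott_or; auto. apply scott_img; auto.
    + now apply tp_in_X.
    + intros o. apply cmp_wcode.
  - apply theory_union.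
    + eapply theory_mono; [apply extends_Lc_S|exact Hth].
    + apply theory_img_tp.
  - destruct (stage_realize N k e T a Hst HN) as [b Hb].
    set (N' := setc N k b).
    assert (HA : agree (Lc L' k) N N') by apply agree_setc.
    destruct (witness_agree N N' k T HA Hth HN) as (W1 & W2 & W3 & W4).
    exists B, N'. repeat split; auto.
    apply models_union; auto. intros p Hp s.
    apply mem_img_tp in Hp as (q & [F Hq] & ->).
    assert (F' : is_form (Lc L' (S k)) (S k) (rn q)).
    { apply is_form_rn. eapply is_form_extends; eauto. }
    apply (sat_Ws N' (Lc L' (S k)) (fun i => i) (S k) _ s (upd (cN N) k b)); auto.
    + intros i Hi. unfold N'. destruct (Nat.eq_dec i k) as [->|Ni].
      * now rewrite upd_eq, cN_setc_same.
      * now rewrite upd_neq, cN_setc_other.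
    + apply (sat_agree (Lc L' k) N N' (rn q) HA (upd (cN N) k b) (upd (cN N) k b)); auto.
      { apply fwf_rn. eapply fwf_extends; [exact HLL'|]. apply F. }
      apply sat_rn. destruct (rotate_vars L k q F) as (r & Fr & Er).
      apply Er, Hb; auto. now apply Er.
  - exists T'. split.
    + split; [|split; [|split; [|split]]]; auto. intros p F H. apply H3, orb_true_iff. right.
      apply mem_img_tp. eauto.
    + intros c Hc'. apply H3. now rewrite Hc'.
Qed.

(* The set of codes of formulas is read off from a complete type, so no separate
   decision procedure for well-formedness is needed. *)
Lemma restriction_in_X k (e : nat -> A) rho T : X T ->
  exists Q, X Q /\ type_in L k Q /\
    forall p, mem Q p <-> is_form L k p /\ mem T (Ws rho k (rn p)).
Proof.
  intros HT. set (t := tp L M k e).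
  assert (Xt : X t) by now apply tp_in_X.
  (* [cp 3 c] codes the negation of the formula coded by [c]; one of the two lies in the complete
     type [t] exactly when [c] codes a formula over [L] in [k] variables. *)
  exists (fun c => T (wcode rho k c) && (t c || t (cp 3 c))).
  assert (Ht : forall c, t c || t (cp 3 c) = true -> exists p, enc p = c /\ is_form L k p).
  { intros c H. apply orb_true_iff in H as [H|H]; apply tp_code in H as (p & E & F); eauto.
    destruct p; simpl in E; apply cp_inj in E as [E1 E2]; try discriminate. eauto. }
  split; [|split].
  - apply scott_and; auto.
    + apply scott_preimage; auto. intros o. apply cmp_wcode.
    + apply scott_or; auto. apply (scott_preimage X Hscott t (fun c => cp 3 c)); auto.
      intros o. cmp_auto.
  - intros c Hc. apply andb_true_iff in Hc as [_ Hc]. auto.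
  - intros p. unfold mem at 1. rewrite wcode_enc, andb_true_iff. split.
    + intros [H K]. split; auto. apply Ht in K as (q & E & F). apply enc_inj in E. now subst.
    + intros [F H]. split; auto. apply orb_true_iff.
      change (mem t p \/ mem t (Neg p)). unfold t. rewrite !mem_tp.
      destruct (classic (sat M e p)); [left|right]; split; auto.
Qed.

(** The wrapping of [Ex x p] also assigns a value to [x], which the inner quantifier overrides; one
    bound [m] thus serves both sides. *)
Definition henkin rho m x p k : form :=
  Imp (Ws rho m (Ex x p)) (Ws (upd rho x k) m p).

(** The opposite order to [stage_add]: the theory is given and the element of [M] is found
    afterwards. Completeness of [T'] determines the [L]-type of the new constant over the old
    ones. *)
Lemma stage_of_theory k e T T' :
  stage k e T -> sub T T' -> X T' -> theory (Lc L' (S k)) T' -> complete (Lc L' (S k)) T' ->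
  Con_sat (Lc L 0) (mem T0) T' P' -> exists a, stage (S k) (upd e k a) T'.
Proof.
  intros (HT & Hth & Hc & _ & Htp) Hsub XT' Hth' Hc' Hcon.
  pose proof Hcon as (B & N & HB & _ & HN & _ & _).
  (* The new constant comes first, as [realize_in_X] expects, followed by the old ones. *)
  set (rho := scons k (fun i => i)).
  destruct (restriction_in_X (S k) e rho T' XT') as (Q & XQ & HQ & memQ).
  assert (Q_N : forall p, is_form L (S k) p ->
    (mem Q p <-> sat (dn N) (scons (cN N k) (cN N)) p)).
  { intros p F. rewrite memQ, <- sat_rn.
    rewrite (mem_Ws L' (S k) T' N rho (S k) (rn p) (scons (cN N k) (cN N))); auto.
    - tauto.
    - apply is_form_rn. eapply is_form_extends; eauto.
    - intros [|i] Hi; simpl; lia.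
    - intros [|i] Hi; reflexivity. }
  destruct (realize_in_X L X M k e Q) as [a Ha]; auto.
  - intros p F. rewrite !Q_N by auto. simpl. apply classic.
  - intros l Hl.
    assert (Fl : forall p, In p l -> is_form L (S k) p) by (intros p Hp; now apply memQ, Hl).
    destruct (exists_shift L k (conj_list l)) as (q & Fq & Eq); [now apply is_form_conj_list|].
    assert (H : sat M e q).
    (* Otherwise the negated existential closure, true of [e] in [M], would belong to [T] and hence
       to [T'], while in [N] the new constant refutes it. *)
    { apply NNPP. intros Hn.
      assert (K : mem T' (Ws (fun i => i) k (rn (Neg q)))) by (apply Hsub, Htp; auto).
      apply (mem_Ws L' (S k) T' N (fun i => i) k (rn (Neg q)) (cN N)) in K; auto.
      - apply sat_rn in K. apply K. apply Eq. exists (cN N k). apply sat_conj_list.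
        intros p Hp. apply Q_N; auto.
      - apply is_form_rn. eapply is_form_extends; [exact HLL'|apply le_n|auto]. }
    apply Eq in H as [b Hb]. exists b. now apply sat_conj_list.
  - exists a. split; [|split; [|split; [|split]]]; auto. intros p F H.
    destruct (rotate_vars L k p F) as (q & Fq & Eq). apply Eq in H.
    apply (mem_Ws L' (S k) T' N (fun i => i) (S k) (rn p) (cN N)); auto.
    + apply is_form_rn. eapply is_form_extends; eauto.
    + apply sat_rn.
      apply (sat_is_form L (S k) (dn N) p (upd (cN N) k (cN N k))); auto.
      * intros i Hi. unfold upd. destruct (Nat.eqb_spec i k); congruence.
      * apply Eq, Q_N; auto. apply NNPP. intros Hn.
        apply (Ha (Neg q)); auto. apply Q_N; auto. intros K. now apply Hn, Q_N.
Qed.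

Lemma stage_henkin k e T rho m x p : stage k e T ->
  is_form (Lc L' k) m p -> x < m -> (forall i, i < m -> rho i < k) ->
  exists a T', stage (S k) (upd e k a) T' /\ sub T T' /\ mem T' (henkin rho m x p k).
Proof.
  intros Hst F Hx R. pose proof Hst as (HT & Hth & Hc & (B & N & HB & HN) & Htp).
  fold (witness N T) in HN.
  set (U := fun c => c =? enc (henkin rho m x p k)).
  destruct (complete_extension (S k) (fun c => T c || U c)) as (T' & XT' & H1 & H2 & H3 & H4).
  - apply scott_or; auto. now apply scott_single.
  - apply theory_union.
    + eapply theory_mono; [apply extends_Lc_S|exact Hth].
    + intros c Hc'. apply Nat.eqb_eq in Hc'. exists (henkin rho m x p k). split; auto.
      assert (F' : is_form (Lc L' (S k)) m p).
      { eapply is_form_extends; [apply extends_Lc_S|apply le_n|exact F]. }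
      destruct (is_form_Ws L' (S k) rho m (Ex x p)) as [W1 G1].
      { now apply is_form_Ex. } { intros i Hi. apply R in Hi. lia. }
      destruct (is_form_Ws L' (S k) (upd rho x k) m p) as [W2 G2]; auto.
      { intros i Hi. unfold upd. apply R in Hi. destruct (i =? x); lia. }
      split; [simpl; now rewrite W1, W2|]. intros y Hy. simpl in Hy.
      apply orb_true_iff in Hy as [Hy|Hy]; auto.
  - set (s0 := fun i => cN N (rho i)).
    (* A true witness if there is one, any element otherwise. This value only certifies [Con_sat];
       the element of [M] is found after the theory has been completed. *)
    assert (Hb : exists b, sat N s0 (Ex x p) -> sat N (upd s0 x b) p).
    { destruct (classic (sat N s0 (Ex x p))) as [[b Hb]|Hn].
      - now exists b.
      - destruct HB as [b]. exists b. intros K. now exfalso. }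
    destruct Hb as [b Hb].
    set (N' := setc N k b).
    assert (HA : agree (Lc L' k) N N') by apply agree_setc.
    destruct (witness_agree N N' k T HA Hth HN) as (W1 & W2 & W3 & W4).
    exists B, N'. repeat split; auto.
    apply models_union; auto. intros q Hq s.
    apply Nat.eqb_eq, enc_inj in Hq. subst q. intros K.
    assert (E0 : forall i, i < m -> s0 i = cN N' (rho i)).
    { intros i Hi. unfold s0, N'. rewrite cN_setc_other; auto. apply R in Hi. lia. }
    apply (sat_Ws N' (Lc L' k) (upd rho x k) m p s (upd s0 x b)); auto.
    + intros i Hi. unfold N'. destruct (Nat.eq_dec i x) as [->|Ni].
      * now rewrite !upd_eq, cN_setc_same.
      * rewrite !upd_neq by auto. now apply E0.
    + apply (sat_agree (Lc L' k) N N' p HA (upd s0 x b) (upd s0 x b)); auto; [apply F|].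
      apply Hb.
      apply (sat_agree (Lc L' k) N N' (Ex x p) HA s0 s0); auto; [apply F|].
      revert K. apply sat_Ws with (L := Lc L' k); auto. now apply is_form_Ex.
  - assert (Hsub : sub T T') by (intros c Hc'; apply H3; now rewrite Hc').
    destruct (stage_of_theory k e T T' Hst Hsub XT' H1 H2 H4) as [a Ha].
    exists a, T'. split; [|split]; auto. apply H3, orb_true_iff. right. apply Nat.eqb_refl.
Qed.

Definition precedes k (e : nat -> A) T k' (e' : nat -> A) T' : Prop :=
  k <= k' /\ (forall i, i < k -> e i = e' i) /\ sub T T'.

Lemma precedes_refl k e T : precedes k e T k e T.
Proof. repeat split; auto. intros c; auto. Qed.

Lemma precedes_trans k e T k' e' T' k'' e'' T'' :
  precedes k e T k' e' T' -> precedes k' e' T' k'' e'' T'' -> precedes k e T k'' e'' T''.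
Proof.
  intros (H1 & H2 & H3) (K1 & K2 & K3). repeat split.
  - lia.
  - intros i Hi. rewrite H2, K2; auto. lia.
  - intros c Hc. auto.
Qed.

Lemma precedes_upd k e T a T' : sub T T' -> precedes k e T (S k) (upd e k a) T'.
Proof. intros H. repeat split; auto. intros i Hi. rewrite upd_neq; auto. lia. Qed.

Lemma stage_grow j k e T : stage k e T ->
  exists k' e' T', stage k' e' T' /\ precedes k e T k' e' T' /\ j <= k'.
Proof.
  intros H. induction j as [|j (k' & e' & T' & H' & Hp & Hj)].
  - exists k, e, T. split; [|split]; auto using precedes_refl. lia.
  (* Several constants may name the same element, so any element serves to lengthen the tuple. *)
  - destruct (stage_add k' e' T' (e' 0) H') as (T'' & H'' & Hs).
    exists (S k'), (upd e' k' (e' 0)), T''. split; [|split]; auto; [|lia].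
    eapply precedes_trans; [exact Hp|]. now apply precedes_upd.
Qed.

Lemma Ws_ext rho rho' m p : (forall i, i < m -> rho i = rho' i) -> Ws rho m p = Ws rho' m p.
Proof.
  intros E. unfold Ws. f_equal. apply map_ext_in. intros i Hi. apply in_seq in Hi.
  rewrite E; auto. lia.
Qed.

(** The bound on [rho] is included so that the instance is in the language of the stage and its
    completeness applies. *)
Definition has_witness rho m x p k T : Prop :=
  (forall i, i < m -> rho i < k) /\
  (mem T (Ws rho m (Ex x p)) -> exists j, j < k /\ mem T (Ws (upd rho x j) m p)).

Lemma stage_has_witness rho m x p k e T : stage k e T -> is_form L' m p -> x < m ->
  exists k' e' T', stage k' e' T' /\ precedes k e T k' e' T' /\ has_witness rho m x (rn p) k' T'.
Proof.
  intros H F Hx.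
  assert (Hb : exists j, forall i, i < m -> rho i < j).
  { clear. induction m as [|m [j IH]]; [now exists 0|].
    exists (S (j + rho m)). intros i Hi. destruct (Nat.eq_dec i m) as [->|]; [lia|].
    specialize (IH i). lia. }
  destruct Hb as [j Hj].
  (* The constants mentioned by [rho] may not exist yet, so the language is enlarged first. *)
  destruct (stage_grow j k e T H) as (k1 & e1 & T1 & H1 & P1 & J1).
  assert (R : forall i, i < m -> rho i < k1) by (intros i Hi; apply Hj in Hi; lia).
  destruct (stage_henkin k1 e1 T1 rho m x (rn p) H1) as (a & T2 & H2 & S2 & K2); auto.
  { now apply is_form_rn. }
  exists (S k1), (upd e1 k1 a), T2. split; [|split]; auto.
  { eapply precedes_trans; [exact P1|]. now apply precedes_upd. }
  split; [intros i Hi; apply R in Hi; lia|]. intros K. exists k1. split; auto.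
  destruct H2 as (_ & _ & Hc & (B & N & [b] & _ & HN & _) & _).
  assert (F' : is_form (Lc L' (S k1)) m (rn p)) by now apply is_form_rn.
  set (s := fun i => cN N (upd rho x k1 i)).
  apply (mem_Ws L' (S k1) T2 N (upd rho x k1) m (rn p) s); auto.
  { intros i Hi. unfold upd. apply R in Hi. destruct (i =? x); lia. }
  apply (sat_Ws N (Lc L' (S k1)) (upd rho x k1) m (rn p) s s); auto.
  apply (HN _ K2 s). now apply HN.
Qed.

End Stages.

(** * The limit structure *)

Section Limit.
Context {A : Type} (L L' : lang) (M : structure A) (X : (nat -> bool) -> Prop)
  (T0 P' : nat -> bool) (kk : nat -> nat) (ee : nat -> nat -> A) (TT : nat -> nat -> bool).
Hypothesis HLL' : extends L L'.
Hypothesis Hstage : forall t, stage L L' M X T0 P' (kk t) (ee t) (TT t).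
Hypothesis Hmono : forall t u, t <= u -> precedes (kk t) (ee t) (TT t) (kk u) (ee u) (TT u).
Hypothesis Hgrow : forall t, t < kk (S t).
Hypothesis Hsurj : forall a, exists t j, j < kk t /\ ee t j = a.
Hypothesis Hwit : forall rho m x p, is_form L' m p -> x < m ->
  exists t, has_witness rho m x (rn p) (kk t) (TT t).

(** By [Hgrow] constant [j] exists at stage [S j], and by [Hmono] its value never changes later. *)
Definition elt (j : nat) : A := ee (S j) j.

Lemma E_stage t j : j < kk t -> ee t j = elt j.
Proof.
  intros H. unfold elt. destruct (Hmono t (max t (S j))) as (_ & K & _); [lia|].
  destruct (Hmono (S j) (max t (S j))) as (_ & K' & _); [lia|].
  rewrite K, K'; auto.
Qed.

Lemma E_surj a : exists j, elt j = a.
Proof. destruct (Hsurj a) as (t & j & H & <-). exists j. symmetry. now apply E_stage. Qed.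

(* The models of the stages need not form a chain; [ev Phi] says that [Phi] holds
   in every model of every late enough stage. *)
Definition ev (Phi : forall B, structure B -> Prop) : Prop :=
  exists t0, forall t, t0 <= t -> forall B (N : structure B), inhabited B ->
    models N (TT t) -> Phi B N.

Lemma ev_mono Phi Psi : (forall B N, Phi B N -> Psi B N) -> ev Phi -> ev Psi.
Proof. intros H [t0 K]. exists t0. intros. apply H. eapply K; eauto. Qed.

Lemma ev_and (Phi Psi : forall B, structure B -> Prop) :
  ev Phi -> ev Psi -> ev (fun B N => Phi B N /\ Psi B N).
Proof.
  intros [t H] [u K]. exists (max t u). intros v Hv B N HB HN. split.
  - apply (H v); auto; lia.
  - apply (K v); auto; lia.
Qed.

Lemma ev_model t : exists B (N : structure B), inhabited B /\ models N (TT t) /\ omits N P'.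
Proof.
  destruct (Hstage t) as (_ & _ & _ & (B & N & HB & _ & HN & HO & _) & _).
  now exists B, N.
Qed.

Lemma ev_false : ~ ev (fun _ _ => False).
Proof.
  intros [t H]. destruct (ev_model t) as (B & N & HB & HN & _). exact (H t (le_n t) B N HB HN).
Qed.

Lemma ev_true (Phi : forall B, structure B -> Prop) : (forall B N, Phi B N) -> ev Phi.
Proof. intros H. exists 0. intros; apply H. Qed.

Lemma bound_stage rho m : exists t, forall i, i < m -> rho i < kk t.
Proof.
  induction m as [|m [t IH]]; [exists 0; lia|].
  exists (max t (S (rho m))). intros i Hi.
  destruct (Hmono t (max t (S (rho m)))) as (H & _); [lia|].
  destruct (Hmono (S (rho m)) (max t (S (rho m)))) as (K & _); [lia|].
  pose proof (Hgrow (rho m)).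
  destruct (Nat.eq_dec i m) as [->|]; [lia|]. specialize (IH i). lia.
Qed.

(** The intended truth relation of the limit, with constants in place of elements. *)
Definition evs (rho : nat -> nat) (p : form) : Prop :=
  ev (fun B N => sat (dn N) (fun i => cN N (rho i)) p).

Lemma evs_of_mem t rho m p : is_form L' m p -> mem (TT t) (Ws rho m (rn p)) -> evs rho p.
Proof.
  intros F H. exists t. intros u Hu B N HB HN.
  destruct (Hmono t u Hu) as (_ & _ & Hs).
  assert (F' : is_form (Lc L' 0) m (rn p)) by now apply is_form_rn.
  apply sat_rn.
  apply (sat_Ws N (Lc L' 0) rho m (rn p) (fun i => cN N (rho i))); auto.
  apply HN, Hs, H.
Qed.

Lemma mem_of_sat t rho m p B (N : structure B) : models N (TT t) -> is_form L' m p ->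
  (forall i, i < m -> rho i < kk t) -> sat (dn N) (fun i => cN N (rho i)) p ->
  mem (TT t) (Ws rho m (rn p)).
Proof.
  intros HN F R H. destruct (Hstage t) as (_ & _ & Hc & _).
  apply (mem_Ws L' (kk t) (TT t) N rho m (rn p) (fun i => cN N (rho i))); auto.
  - now apply is_form_rn.
  - now apply sat_rn.
Qed.

(** By completeness, an instance true in one model of a stage lies in the theory of that stage, and
    so holds in all models of later stages. *)
Lemma evs_dec rho m p : is_form L' m p -> evs rho p \/ evs rho (Neg p).
Proof.
  intros F. destruct (bound_stage rho m) as [t R].
  destruct (ev_model t) as (B & N & HB & HN & _).
  destruct (classic (sat (dn N) (fun i => cN N (rho i)) p)) as [H|H]; [left|right].
  - eapply evs_of_mem; eauto. eapply mem_of_sat; eauto.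
  - eapply (evs_of_mem t rho m (Neg p)); eauto. eapply (mem_of_sat t rho m (Neg p)); eauto.
Qed.

Lemma evs_not rho p : evs rho p -> evs rho (Neg p) -> False.
Proof.
  intros H K. apply ev_false. eapply ev_mono; [|exact (ev_and _ _ H K)].
  simpl. intros B N [G G']. auto.
Qed.

(** [Hwit] yields a witness only if the existential sentence is in the theory of that stage. If it
    were not, completeness would put its negation there, against its eventual truth. *)
Lemma evs_Ex rho m x p : is_form L' m p -> x < m -> evs rho (Ex x p) ->
  exists j, evs (upd rho x j) p.
Proof.
  intros F Hx H. destruct (Hwit rho m x p F Hx) as (t & R & K).
  assert (FE : is_form L' m (Ex x p)) by now apply is_form_Ex.
  destruct K as (j & Hj & K).
  - destruct H as [t0 H]. destruct (ev_model (max t t0)) as (B & N & HB & HN & _).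
    assert (S : mem (TT t) (Ws rho m (rn (Ex x p))) \/ mem (TT t) (Ws rho m (rn (Neg (Ex x p))))).
    { destruct (ev_model t) as (B1 & N1 & HB1 & HN1 & _).
      destruct (classic (sat (dn N1) (fun i => cN N1 (rho i)) (Ex x p))) as [G|G]; [left|right];
        eapply mem_of_sat; eauto. }
    destruct S as [S|S]; auto. exfalso.
    assert (E1 : evs rho (Ex x p)) by now exists t0.
    apply (evs_not rho (Ex x p) E1). eapply (evs_of_mem t rho m (Neg (Ex x p))); eauto.
  - exists j. eapply evs_of_mem; eauto.
Qed.

(** The link from [M] to the stages: after renaming variables, [p] belongs to the type of the first
    [kk t] named elements. *)
Lemma evs_base rho m p : is_form L m p -> sat M (fun i => elt (rho i)) p -> evs rho p.
Proof.
  intros F H. destruct (bound_stage rho m) as [t R].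
  destruct (rename_vars L m (kk t) rho p F R) as (q & Fq & Eq).
  assert (K : mem (TT t) (Ws (fun i => i) (kk t) (rn q))).
  { destruct (Hstage t) as (_ & _ & _ & _ & Htp). apply Htp; auto.
    apply Eq. revert H. apply (sat_is_form L m); auto.
    intros i Hi. apply E_stage; auto. }
  apply evs_of_mem in K; [|eapply is_form_extends; eauto].
  revert K. apply ev_mono. intros B N. apply Eq.
Qed.

Lemma ev_eq i j : elt i = elt j -> ev (fun B N => cN N i = cN N j).
Proof.
  intros H. set (rho := fun x => match x with 0 => i | _ => j end).
  apply (evs_base rho 2 (Eqf (Var 0) (Var 1))); [|exact H].
  split; auto. intros x Hx. destruct x as [|[|x]]; [lia|lia|discriminate].
Qed.

Lemma ev_neq i j : elt i <> elt j -> ev (fun B N => cN N i <> cN N j).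
Proof.
  intros H. set (rho := fun x => match x with 0 => i | _ => j end).
  apply (evs_base rho 2 (Neg (Eqf (Var 0) (Var 1)))); [|exact H].
  split; auto. intros x Hx. destruct x as [|[|x]]; [lia|lia|discriminate].
Qed.

Lemma ev_eq_inv i j : ev (fun B N => cN N i = cN N j) -> elt i = elt j.
Proof.
  intros H. apply NNPP. intros K. apply ev_false. eapply ev_mono; [|exact (ev_and _ _ H (ev_neq i j K))].
  simpl. tauto.
Qed.

Lemma ev_eq_list is : forall js, map elt is = map elt js -> ev (fun B N => map (cN N) is = map (cN N) js).
Proof.
  induction is as [|i is IH]; intros [|j js] H; simpl in H; try discriminate.
  - now apply ev_true.
  - injection H as H1 H2. eapply ev_mono; [|exact (ev_and _ _ (ev_eq i j H1) (IH js H2))].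
    simpl. intros B N [-> ->]. reflexivity.
Qed.

Lemma E_surj_list l : exists js, map elt js = l.
Proof.
  induction l as [|a l [js IH]]; [now exists []|].
  destruct (E_surj a) as [j Hj]. exists (j :: js). simpl. congruence.
Qed.

Definition vars (m : nat) : list term := map Var (seq 0 m).

Lemma map_vars {B} (N : structure B) (g : nat -> B) js :
  map (teval N (fun i => g (nth i js 0))) (vars (length js)) = map g js.
Proof.
  unfold vars. rewrite map_map. simpl.
  induction js as [|j js IH]; auto. simpl. f_equal.
  rewrite <- seq_shift, map_map. exact IH.
Qed.

Lemma map_vars_upd {B} (N : structure B) (g : nat -> B) js b :
  map (teval N (upd (fun i => g (nth i js 0)) (length js) b)) (vars (length js)) = map g js.
Proof.
  rewrite <- (map_vars N g js). apply map_ext_in. intros t I.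
  apply in_map_iff in I as (i & <- & I). apply in_seq in I.
  cbn [teval]. now rewrite upd_neq by lia.
Qed.

Lemma vars_wf K m : forallb (twf K) (vars m) = true.
Proof. unfold vars. rewrite forallb_forall. intros t H. apply in_map_iff in H as (i & <- & _). reflexivity. Qed.

Lemma vars_occ x m : existsb (tocc x) (vars m) = true -> x < m.
Proof.
  rewrite existsb_exists. intros (t & I & H). apply in_map_iff in I as (i & <- & I).
  apply in_seq in I. simpl in H. apply Nat.eqb_eq in H. lia.
Qed.

Lemma is_form_rel K r m : rel_ar K r = Some m -> is_form K m (Rel r (vars m)).
Proof.
  intros H. split.
  - cbn [fwf]. unfold vars at 1. rewrite length_map, length_seq, vars_wf.
    now rewrite (some_ar_is _ _ H).
  - intros x Hx. now apply vars_occ.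
Qed.

Lemma is_form_fun K f m : fun_ar K f = Some m ->
  is_form K (S m) (Eqf (App f (vars m)) (Var m)).
Proof.
  intros H. split.
  - cbn [fwf twf]. unfold vars at 1. rewrite length_map, length_seq, vars_wf.
    now rewrite (some_ar_is _ _ H).
  - intros x Hx. cbn [free tocc] in Hx. apply orb_true_iff in Hx as [Hx|Hx].
    + apply vars_occ in Hx. lia.
    + apply Nat.eqb_eq in Hx. lia.
Qed.

Definition fun_graph (f : nat) (l : list A) (a : A) : Prop :=
  exists js j, l = map elt js /\ a = elt j /\ ev (fun B N => sfun (dn N) f (map (cN N) js) = cN N j).

Lemma fun_graph_unique f l a b : fun_graph f l a -> fun_graph f l b -> a = b.
Proof.
  intros (is & i & -> & -> & H) (js & j & Ej & -> & K). apply ev_eq_inv.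
  eapply ev_mono; [|exact (ev_and _ _ (ev_and _ _ H K) (ev_eq_list is js Ej))].
  intros B N [[H1 H2] H3]. rewrite H3 in H1. congruence.
Qed.

(** That [f] has a value is a valid existential sentence, and its Henkin witness names the value. *)
Lemma fun_value f js : fun_ar L' f = Some (length js) ->
  exists j, ev (fun B N => sfun (dn N) f (map (cN N) js) = cN N j).
Proof.
  intros H. pose proof (is_form_fun L' f _ H) as F.
  set (rho := fun i => nth i js 0).
  destruct (evs_Ex rho (S (length js)) (length js) (Eqf (App f (vars (length js))) (Var (length js))))
    as [j Hj]; auto.
  - apply ev_true. intros B N. exists (sfun (dn N) f (map (cN N) js)). cbn [sat teval].
    unfold rho. now rewrite (map_vars_upd (dn N)), upd_eq.
  - exists j. revert Hj. apply ev_mono. intros B N. cbn [sat teval].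
    rewrite upd_eq. intros <-. f_equal. rewrite <- (map_vars_upd (dn N) (cN N) js (cN N j)).
    apply map_ext. intros t. apply teval_ext. intros x _. unfold upd, rho. now destruct (x =? length js).
Qed.

(** Since [A] itself is the carrier, no quotient of constants is formed: constants naming equal
    elements are eventually equal. Where a graph is empty, as can happen outside [L'], [epsilon]
    returns an arbitrary value. *)
Definition Mlim : structure A :=
  Struct A
    (fun r l => exists js, l = map elt js /\ ev (fun B N => srel (dn N) r (map (cN N) js)))
    (fun f l => epsilon (inhabits (elt 0)) (fun_graph f l)).

Lemma Mlim_fun f js j : ev (fun B N => sfun (dn N) f (map (cN N) js) = cN N j) ->
  sfun Mlim f (map elt js) = elt j.
Proof.
  intros H. assert (G : fun_graph f (map elt js) (elt j)) by (exists js, j; auto).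
  apply (fun_graph_unique f (map elt js)); auto. simpl. apply epsilon_spec. eauto.
Qed.

Lemma Mlim_rel r js : srel Mlim r (map elt js) <-> ev (fun B N => srel (dn N) r (map (cN N) js)).
Proof.
  split.
  - intros (is & Ei & H). eapply ev_mono; [|exact (ev_and _ _ H (ev_eq_list js is Ei))].
    intros B N [H1 H2]. now rewrite H2.
  - intros H. exists js. auto.
Qed.

Lemma Mlim_term rho t : twf L' t = true -> exists j,
  teval Mlim (fun i => elt (rho i)) t = elt j /\
  ev (fun B N => teval (dn N) (fun i => cN N (rho i)) t = cN N j).
Proof.
  induction t as [n|f ts IH] using term_ind_list; intros W.
  - exists (rho n). split; auto. now apply ev_true.
  - cbn [twf] in W. bools.
    assert (Hjs : exists js, map (teval Mlim (fun i => elt (rho i))) ts = map elt js /\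
      ev (fun B N => map (teval (dn N) (fun i => cN N (rho i))) ts = map (cN N) js)).
    { clear H. induction IH as [|t ts Ht _ IHts].
      - exists []. split; auto. now apply ev_true.
      - simpl in H0. bools. destruct (Ht H) as (j & E1 & H1).
        destruct (IHts H0) as (js & E2 & H2). exists (j :: js). simpl. split; [congruence|].
        eapply ev_mono; [|exact (ev_and _ _ H1 H2)]. intros B N [-> ->]. reflexivity. }
    destruct Hjs as (js & E1 & H1).
    destruct (fun_value f js) as [j Hj].
    { apply ar_is_some in H. rewrite H. f_equal.
      now rewrite <- (length_map elt js), <- E1, length_map. }
    exists j. cbn [teval]. rewrite E1. split; [now apply Mlim_fun|].
    eapply ev_mono; [|exact (ev_and _ _ H1 Hj)]. intros B N [-> <-]. reflexivity.
Qed.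

(** The bound is also kept above [x], because [Hwit] needs the quantified variable below it. *)
Lemma is_form_bound K p : fwf K p = true -> forall x, exists m, x < m /\ is_form K m p.
Proof.
  intros W x.
  assert (T : forall t, exists m, forall y, tocc y t = true -> y < m).
  { induction t as [n|f ts IH] using term_ind_list.
    - exists (S n). intros y Hy. simpl in Hy. apply Nat.eqb_eq in Hy. lia.
    - induction IH as [|t ts [m Ht] _ [k IHts]]; [now exists 0|].
      exists (m + k). intros y Hy. simpl in *. apply orb_true_iff in Hy as [Hy|Hy].
      + apply Ht in Hy. lia.
      + apply IHts in Hy. lia. }
  assert (G : exists m, forall y, free y p = true -> y < m).
  { clear W. induction p; simpl;
      try (destruct IHp1 as [m1 H1], IHp2 as [m2 H2]; exists (m1 + m2); intros y Hy;
           apply orb_true_iff in Hy as [Hy|Hy]; [apply H1 in Hy|apply H2 in Hy]; lia).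
    - exists 0. discriminate.
    - destruct (T t) as [m1 H1], (T u) as [m2 H2]. exists (m1 + m2). intros y Hy.
      apply orb_true_iff in Hy as [Hy|Hy]; [apply H1 in Hy|apply H2 in Hy]; lia.
    - apply (T (App r ts)).
    - exact IHp.
    - destruct IHp as [m H]. exists m. intros y Hy. apply andb_true_iff in Hy as [_ Hy]. auto.
    - destruct IHp as [m H]. exists m. intros y Hy. apply andb_true_iff in Hy as [_ Hy]. auto. }
  destruct G as [m H]. exists (S (x + m)). split; [lia|]. split; auto.
  intros y Hy. apply H in Hy. lia.
Qed.

Lemma evs_Neg rho p : fwf L' p = true -> (evs rho (Neg p) <-> ~ evs rho p).
Proof.
  intros W. destruct (is_form_bound L' p W 0) as (m & _ & F). split.
  - intros H K. exact (evs_not rho p K H).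
  - intros H. destruct (evs_dec rho m p F); tauto.
Qed.

Lemma evs_Conj rho p q : evs rho (Conj p q) <-> evs rho p /\ evs rho q.
Proof.
  split.
  - intros H. split; revert H; apply ev_mono; intros B N []; auto.
  - intros [H K]. apply (ev_and _ _ H K).
Qed.

Lemma evs_equiv rho p q :
  (forall B (N : structure B) s, sat N s p <-> sat N s q) -> (evs rho p <-> evs rho q).
Proof. intros H. split; apply ev_mono; intros B N; apply H. Qed.

Lemma evs_Ex_iff rho x p : fwf L' p = true ->
  (evs rho (Ex x p) <-> exists j, evs (upd rho x j) p).
Proof.
  intros W. destruct (is_form_bound L' p W x) as (m & Hx & F). split.
  - now apply (evs_Ex rho m).
  - intros [j H]. revert H. apply ev_mono. intros B N H. exists (cN N j).
    revert H. apply (sat_is_form L' m); auto. intros i _. unfold upd. now destruct (i =? x).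
Qed.

(** Negation rests on completeness of the stages, and the existential case on Henkin witnesses
    together with the fact that every element of [A] is named. *)
Theorem Mlim_truth p : fwf L' p = true -> forall rho,
  sat Mlim (fun i => elt (rho i)) p <-> evs rho p.
Proof.
  assert (U : forall p rho x j, fwf L' p = true ->
    (sat Mlim (upd (fun i => elt (rho i)) x (elt j)) p <-> sat Mlim (fun i => elt (upd rho x j i)) p)).
  { intros q rho x j W. apply (sat_agree L'); auto using agree_refl.
    intros y _. unfold upd. now destruct (y =? x). }
  induction p; intros W rho; cbn [fwf] in W; bools.
  - simpl. split; [tauto|]. intros H. exact (ev_false H).
  - destruct (Mlim_term rho t H) as (i & Ei & Hi), (Mlim_term rho u H0) as (j & Ej & Hj).
    simpl. rewrite Ei, Ej. split.
    + intros K. eapply ev_mono; [|exact (ev_and _ _ (ev_eq i j K) (ev_and _ _ Hi Hj))].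
      simpl. intros B N (K1 & K2 & K3). congruence.
    + intros K. apply ev_eq_inv. eapply ev_mono; [|exact (ev_and _ _ K (ev_and _ _ Hi Hj))].
      simpl. intros B N (K1 & K2 & K3). congruence.
  - assert (Hjs : exists js, map (teval Mlim (fun i => elt (rho i))) ts = map elt js /\
      ev (fun B N => map (teval (dn N) (fun i => cN N (rho i))) ts = map (cN N) js)).
    { clear H. induction ts as [|t ts IHts].
      - exists []. split; auto. now apply ev_true.
      - simpl in H0. bools. destruct (Mlim_term rho t H) as (j & E1 & H1).
        destruct (IHts H0) as (js & E2 & H2). exists (j :: js). simpl. split; [congruence|].
        eapply ev_mono; [|exact (ev_and _ _ H1 H2)]. intros B N [-> ->]. reflexivity. }
    destruct Hjs as (js & E1 & H1). cbn [sat]. rewrite E1, Mlim_rel. split.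
    + intros K. eapply ev_mono; [|exact (ev_and _ _ H1 K)].
      cbn [sat]. intros B N [G1 G2]. now rewrite G1.
    + intros K. eapply ev_mono; [|exact (ev_and _ _ H1 K)].
      cbn [sat]. intros B N [G1 G2]. now rewrite <- G1.
  - cbn [sat]. rewrite IHp, evs_Neg; tauto.
  (* [evs] commutes directly with [Neg], [Conj] and [Ex]; the other connectives are reduced to these
     classically. *)
  - rewrite (evs_equiv rho (Imp p1 p2) (Neg (Conj p1 (Neg p2)))).
    + rewrite evs_Neg, evs_Conj, evs_Neg; auto; [|cbn [fwf]; now rewrite H].
      cbn [sat]. rewrite IHp1, IHp2; auto. tauto.
    + intros B N s. simpl. tauto.
  - rewrite evs_Conj. cbn [sat]. rewrite IHp1, IHp2; tauto.
  - rewrite (evs_equiv rho (Disj p1 p2) (Neg (Conj (Neg p1) (Neg p2)))).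
    + rewrite evs_Neg, evs_Conj, !evs_Neg; auto; [|cbn [fwf]; now rewrite H].
      cbn [sat]. rewrite IHp1, IHp2; auto. tauto.
    + intros B N s. simpl. tauto.
  - rewrite (evs_equiv rho (All x p) (Neg (Ex x (Neg p)))).
    + rewrite evs_Neg, evs_Ex_iff; auto. cbn [sat]. split.
      * intros H [j Hj]. apply evs_Neg in Hj; auto. apply Hj.
        apply IHp; auto. apply U; auto.
      * intros H a. destruct (E_surj a) as [j <-]. apply U; auto. apply IHp; auto.
        apply NNPP. intros K. apply H. exists j. now apply evs_Neg.
    + intros B N s. simpl. split; [intros H [a Ha]; auto|].
      intros H a. apply NNPP. eauto.
  - rewrite evs_Ex_iff by auto. cbn [sat]. split.
    + intros [a H]. destruct (E_surj a) as [j <-]. exists j. apply IHp; auto. apply U; auto.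
    + intros [j H]. exists (elt j). apply U; auto. apply IHp; auto.
Qed.

Lemma Mlim_expansion : expansion L M Mlim.
Proof.
  split.
  - intros r m l Hr Hl. destruct (E_surj_list l) as [js <-]. rewrite length_map in Hl. subst m.
    rewrite Mlim_rel. pose proof (is_form_rel L r _ Hr) as F.
    set (rho := fun i => nth i js 0).
    assert (K : evs rho (Rel r (vars (length js))) <->
                ev (fun B N => srel (dn N) r (map (cN N) js))).
    { split; apply ev_mono; intros B N; cbn [sat]; unfold rho; now rewrite (map_vars (dn N)). }
    rewrite <- K. split; intros H.
    (* If the atomic formula failed in [M], its negation would transfer to the stages. *)
    + apply NNPP. intros Hn. apply (evs_not rho _ H). apply (evs_base rho (length js)); auto.
      cbn [sat]. unfold rho. now rewrite (map_vars M).
    + apply (evs_base rho (length js)); auto. cbn [sat]. unfold rho. now rewrite (map_vars M).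
  - intros f m l Hf Hl. destruct (E_surj_list l) as [js <-]. rewrite length_map in Hl. subst m.
    pose proof (is_form_fun L f _ Hf) as F.
    destruct (E_surj (sfun M f (map elt js))) as [j Hj]. rewrite <- Hj.
    apply Mlim_fun.
    set (rho := upd (fun i => nth i js 0) (length js) j).
    assert (G : forall B (N : structure B) (g : nat -> B),
      map (teval N (fun i => g (rho i))) (vars (length js)) = map g js).
    { intros B N g. rewrite <- (map_vars N g js). apply map_ext_in. intros t I.
      apply in_map_iff in I as (i & <- & I). apply in_seq in I.
      cbn [teval]. unfold rho. rewrite upd_neq by lia. reflexivity. }
    assert (H : evs rho (Eqf (App f (vars (length js))) (Var (length js)))).
    { apply (evs_base rho (S (length js))); auto. cbn [sat teval]. rewrite (G A M elt).
      unfold rho. now rewrite upd_eq. }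
    revert H. apply ev_mono. intros B N. cbn [sat teval]. rewrite (G B (dn N) (cN N)).
    unfold rho. now rewrite upd_eq.
Qed.

End Limit.

(** * The expansion theorem *)

(** A one-sided inverse of [dn]. The values at the codes of constants are junk, which [Lc L 0] does
    not see. *)
Definition up {B} (N : structure B) : structure B :=
  Struct B (srel N) (fun f l => sfun N (psnd f) l).

Lemma agree_dn_up {B} L (N : structure B) : agree L (dn (up N)) N.
Proof. split; simpl; [tauto|]. intros f l _. now rewrite psnd_cp. Qed.

Lemma sat_up_rn {B} L (N : structure B) p s : fwf L p = true ->
  (sat (up N) s (rn p) <-> sat N s p).
Proof. intros W. rewrite sat_rn. apply (sat_agree L); auto using agree_dn_up. Qed.

Lemma omega_saturated_up {B} L (N : structure B) :
  omega_saturated L N -> omega_saturated (Lc L 0) (up N).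
Proof.
  intros H k a q Hq Hfin.
  destruct (H k a (fun p => is_form L (S k) p /\ q (rn p))) as [b Hb].
  - tauto.
  - intros l Hl. destruct (Hfin (map rn l)) as [b Hb].
    + intros p Hp. apply in_map_iff in Hp as (r & <- & Hr). now apply Hl.
    + exists b. intros p Hp. destruct (Hl p Hp) as [[W _] _].
      apply (sat_up_rn L); auto. apply Hb. now apply in_map.
  - exists b. intros p Hp. destruct (is_form_Lc0_inv L (S k) p (Hq p Hp)) as (r & <- & F).
    apply (sat_up_rn L); [apply F|]. apply Hb. auto.
Qed.

Section Expansion.
Context {A : Type} (L L' : lang) (M : structure A) (X : (nat -> bool) -> Prop)
  (T P : nat -> bool) (n : nat).
Hypothesis HL : recursive_lang L.
Hypothesis HL' : recursive_lang L'.
Hypothesis HLL' : extends L L'.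
Hypothesis HX : Con_sat_closed X.
Hypothesis HM : X_saturated L X M.
Hypothesis HT : theory L' T.
Hypothesis XT : X T.
Hypothesis HP : type_in L' n P.
Hypothesis XP : X P.

(** With [m = 0] nothing is wrapped, so this is the image under [rn] alone and the lemmas on [wcode]
    apply. *)
Definition rimg (S : nat -> bool) : nat -> bool := img (wcode (fun i => i) 0) S.

Lemma type_in_code K m S : type_in K m S -> forall c, S c = true -> exists q, enc q = c.
Proof. intros H c Hc. destruct (H c Hc) as (q & Eq & _). eauto. Qed.

Lemma mem_rimg K m S p : type_in K m S ->
  (mem (rimg S) p <-> exists q, mem S q /\ p = rn q).
Proof. intros H. exact (mem_img_wcode (fun i => i) 0 S p (type_in_code K m S H)). Qed.

Lemma type_in_rimg K m S : type_in K m S -> type_in (Lc K 0) m (rimg S).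
Proof.
  intros H c Hc. apply (img_wcode_spec (fun i => i) 0 S c (type_in_code K m S H)) in Hc as (q & Hq & ->).
  exists (rn q). split; [reflexivity|]. apply is_form_rn. eapply type_in_mem; eauto.
Qed.

Lemma rimg_in_X S : X S -> X (rimg S).
Proof. intros H. unfold rimg. apply scott_img; auto; [apply HX|]. intros o. apply cmp_wcode. Qed.

Section Start.
Variable e0 : nat -> A.

(** [Th L M] as a set in [X], which closedness requires of the base theory; for sentences the choice
    of [e0] is immaterial. *)
Definition thM : nat -> bool := tp L M 0 e0.

Lemma type_in_thM : type_in L 0 thM.
Proof. intros c. unfold thM. apply tp_code. Qed.

Lemma thM_in_X : X thM.
Proof. unfold thM. apply tp_in_X; auto. apply HX. Qed.

Lemma initial_stage : Con_sat L (Th L M) T P ->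
  exists T1, stage L L' M X (rimg thM) (rimg P) 0 e0 T1 /\ sub (rimg T) T1.
Proof.
  intros (B & N & HB & N0 & N1 & N2 & N3).
  assert (E0 : forall p, mem (rimg thM) p -> exists q, p = rn q /\ Th L M q).
  { intros p Hp. apply (mem_rimg L 0 thM p type_in_thM) in Hp as (q & Hq & ->).
    apply mem_tp in Hq as [F Hq]. exists q. split; auto. split; auto. intros s.
    revert Hq. apply (sat_is_form L 0); auto. lia. }
  (* The theory of [M] is joined to [T] because a stage must contain the [L]-type of its tuple, here
     the empty one. *)
  destruct (complete_extension L L' X (rimg thM) (rimg P) n HL HL' HLL' HX) with
    (k := 0) (T := fun c => rimg T c || rimg thM c) as (T1 & X1 & H1 & H2 & H3 & H4).
  - apply (type_in_rimg L 0), type_in_thM.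
  - apply rimg_in_X, thM_in_X.
  - now apply type_in_rimg.
  - now apply rimg_in_X.
  - apply scott_or; try apply HX; apply rimg_in_X; auto. apply thM_in_X.
  - apply theory_union.
    + exact (type_in_rimg L' 0 T HT).
    + apply (type_in_rimg L' 0). intros c Hc. destruct (type_in_thM c Hc) as (p & Ep & F).
      exists p. split; auto. eapply is_form_extends; eauto.
  - assert (M0 : forall p, mem (rimg thM) p -> forall s, sat (up N) s p).
    { intros p Hp s. apply E0 in Hp as (q & -> & Hq). apply (sat_up_rn L); [apply Hq|].
      now apply N0. }
    exists B, (up N). split; [exact HB|split; [exact M0|split; [|split]]].
    + apply models_union; auto. intros p Hp s.
      apply (mem_rimg L' 0 T p HT) in Hp as (q & Hq & ->).
      apply (sat_up_rn L'); [|now apply N1]. apply (type_in_mem L' 0 T q HT Hq).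
    + intros s. destruct (N2 s) as (p & Hp & K). exists (rn p). split.
      * apply (mem_rimg L' n P); eauto.
      * rewrite (sat_up_rn L'); auto. apply (type_in_mem L' n P p HP Hp).
    + now apply omega_saturated_up.
  - exists T1. split.
    + repeat split; auto. intros p F H. apply H3, orb_true_iff. right.
      apply (mem_rimg L 0 thM (rn p) type_in_thM). exists p. split; auto. now apply mem_tp.
    + intros c Hc. apply H3. now rewrite Hc.
Qed.

Notation stage' := (stage L L' M X (rimg thM) (rimg P)).

Lemma stage_chain T1 : countable A -> stage' 0 e0 T1 ->
  exists kk ee TT, TT 0 = T1 /\ (forall t, stage' (kk t) (ee t) (TT t)) /\
    (forall t u, t <= u -> precedes (kk t) (ee t) (TT t) (kk u) (ee u) (TT u)) /\
    (forall t, t < kk (S t)) /\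
    (forall a, exists t j, j < kk t /\ ee t j = a) /\
    (forall rho m x p, is_form L' m p -> x < m ->
      exists t, has_witness rho m x (rn p) (kk t) (TT t)).
Proof.
  intros [code Hcode] H1.
  set (st := (nat * (nat -> A) * (nat -> bool))%type).
  set (St := {s : st | let '(k, e, T) := s in stage' k e T}).
  set (K := fun s : St => fst (fst (proj1_sig s))).
  set (Ee := fun s : St => snd (fst (proj1_sig s))).
  set (TT := fun s : St => snd (proj1_sig s)).
  (* A requirement (x, p, rho) is coded by the formula [All x (p /\ Rel 0 rho)]. *)
  set (D := fun i s => i < K s /\ (forall a, code a = i -> exists j, j < K s /\ Ee s j = a) /\
    forall x p rho, enc (All x (Conj p (Rel 0 (map Var rho)))) = i ->
      is_form L' (length rho) p -> x < length rho ->
      has_witness (fun i => nth i rho 0) (length rho) x (rn p) (K s) (TT s)).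
  assert (HT0' : theory (Lc L 0) (rimg thM)) by apply (type_in_rimg L 0), type_in_thM.
  assert (XT0' : X (rimg thM)) by apply rimg_in_X, thM_in_X.
  assert (HP0 : type_in (Lc L' 0) n (rimg P)) by now apply type_in_rimg.
  assert (XP0 : X (rimg P)) by now apply rimg_in_X.
  destruct (chain_exists St
    (fun s t => precedes (K s) (Ee s) (TT s) (K t) (Ee t) (TT t)) D)
    with (s0 := exist (fun s : st => let '(k, e, T) := s in stage' k e T) (0, e0, T1) H1)
    as (c & C0 & Cm & CD).
  - intros s. apply precedes_refl.
  - intros s t u. apply precedes_trans.
  - intros i [[[k e] T'] Hs].
    assert (S1 : exists k1 e1 T2, stage' k1 e1 T2 /\ precedes k e T' k1 e1 T2 /\
      forall a, code a = i -> exists j, j < k1 /\ e1 j = a).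
    { destruct (classic (exists a, code a = i)) as [[a Ea]|Na].
      - destruct (stage_add L L' M X (rimg thM) (rimg P) n) with (k := k) (e := e) (T := T') (a := a)
          as (T2 & H2 & S2); auto.
        exists (S k), (upd e k a), T2. split; [|split]; auto using precedes_upd.
        intros a' Ea'. exists k. split; auto. rewrite upd_eq. apply Hcode. congruence.
      - exists k, e, T'. split; [|split]; auto using precedes_refl. intros a Ea. exfalso; eauto. }
    destruct S1 as (k1 & e1 & T2 & H2 & Pr2 & Ha).
    destruct (stage_grow L L' M X (rimg thM) (rimg P) n) with (k := k1) (e := e1) (T := T2) (j := S i)
      as (k2 & e2 & T3 & H3 & Pr3 & Hi); auto.
    assert (S4 : exists k3 e3 T4, stage' k3 e3 T4 /\ precedes k2 e2 T3 k3 e3 T4 /\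
      forall x p rho, enc (All x (Conj p (Rel 0 (map Var rho)))) = i ->
      is_form L' (length rho) p -> x < length rho ->
      has_witness (fun i => nth i rho 0) (length rho) x (rn p) k3 T4).
    { destruct (classic (exists x p rho, enc (All x (Conj p (Rel 0 (map Var rho)))) = i /\
        is_form L' (length rho) p /\ x < length rho)) as [(x & p & rho & Ei & F & Hx)|Nn].
      - destruct (stage_has_witness L L' M X (rimg thM) (rimg P) n) with (k := k2) (e := e2)
          (T := T3) (m := length rho) (x := x) (p := p) (rho := fun i => nth i rho 0)
          as (k3 & e3 & T4 & H4 & Pr4 & W4); auto.
        exists k3, e3, T4. split; [|split]; auto. intros x' p' rho' Ei' _ _.
        rewrite <- Ei' in Ei. apply enc_inj in Ei. injection Ei as -> -> Er.
        assert (rho = rho') as <-; auto.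
        clear - Er. revert rho' Er. induction rho as [|r rho IH]; intros [|r' rho'] Er;
          simpl in Er; try discriminate; auto. injection Er as -> Er. f_equal; auto.
      - exists k2, e2, T3. split; [|split]; auto using precedes_refl.
        intros x p rho Ei F Hx. exfalso. apply Nn. eauto 6. }
    destruct S4 as (k3 & e3 & T4 & H4 & Pr4 & HW).
    exists (exist (fun s : st => let '(k, e, T) := s in stage' k e T) (k3, e3, T4) H4).
    unfold D, K, Ee, TT. simpl. split; [|split; [|split]]; auto.
    + eapply precedes_trans; [exact Pr2|]. eapply precedes_trans; [exact Pr3|exact Pr4].
    + destruct Pr4 as (G & _). lia.
    + intros a Ea. destruct (Ha a Ea) as (j & Hj & Ej).
      destruct (precedes_trans _ _ _ _ _ _ _ _ _ Pr3 Pr4) as (G1 & G2 & _).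
      exists j. split; [lia|]. rewrite <- G2; auto.
  - exists (fun t => K (c t)), (fun t => Ee (c t)), (fun t => TT (c t)).
    split; [now rewrite C0|]. split; [|split; [|split; [|split]]].
    + intros t. unfold K, Ee, TT. destruct (c t) as [[[k e] T'] Hs]. exact Hs.
    + exact Cm.
    + intros t. apply (CD t).
    + intros a. exists (S (code a)). now apply (CD (code a)).
    + intros rho m x p F Hx.
      (* Only the first [m] values of [rho] matter, so a finite list replaces it and the
         requirements are countable in number. *)
      set (l := map rho (seq 0 m)).
      assert (El : length l = m) by (unfold l; now rewrite length_map, length_seq).
      exists (S (enc (All x (Conj p (Rel 0 (map Var l)))))).
      destruct (CD (enc (All x (Conj p (Rel 0 (map Var l)))))) as (_ & _ & W).
      specialize (W x p l eq_refl). rewrite El in W. destruct (W F Hx) as (R & W').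
      assert (Er : forall i, i < m -> nth i l 0 = rho i).
      { intros i Hi. unfold l. rewrite (nth_indep _ _ (rho 0)) by now rewrite length_map, length_seq.
        rewrite map_nth, seq_nth; auto. }
      split; [intros i Hi; rewrite <- Er by auto; now apply R|].
      rewrite (Ws_ext rho (fun i => nth i l 0)) by (intros; now rewrite Er).
      intros Hm. destruct (W' Hm) as (j & Hj & Hm'). exists j. split; auto.
      rewrite (Ws_ext (upd rho x j) (upd (fun i => nth i l 0) x j)); auto.
      intros i Hi. unfold upd. destruct (i =? x); auto. now rewrite Er.
Qed.

End Start.

Theorem Con_sat_expansion : inhabited A -> countable A -> Con_sat L (Th L M) T P ->
  exists M' : structure A, expansion L M M' /\ models M' T /\ omits M' P.
Proof.
  intros [a0] Hc HC. set (e0 := fun _ : nat => a0).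
  destruct (initial_stage e0 HC) as (T1 & H1 & S1).
  destruct (stage_chain e0 T1 Hc H1) as (kk & ee & TT & E0 & Hst & Hm & Hg & Hs & Hw).
  assert (Truth := fun p W => Mlim_truth L L' M X _ _ kk ee TT HLL' Hst Hm Hg Hs Hw p W).
  assert (Vals : forall s : nat -> A, exists rho, forall i, s i = elt ee (rho i)).
  { intros s.
    assert (H : forall i, exists j, elt ee j = s i) by (intros i; eapply E_surj; eauto).
    exists (fun i => proj1_sig (constructive_indefinite_description _ (H i))).
    intros i. symmetry. apply (proj2_sig (constructive_indefinite_description _ (H i))). }
  assert (Sat : forall s rho p, (forall i, s i = elt ee (rho i)) -> fwf L' p = true ->
    (sat (Mlim ee TT) s p <-> evs TT rho p)).
  { intros s rho p Es W. rewrite <- Truth by auto. apply (sat_agree L'); auto using agree_refl. }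
  exists (Mlim ee TT). split; [|split].
  - eapply Mlim_expansion; eauto.
  - intros p Hp s. destruct (Vals s) as [rho Es]. pose proof (type_in_mem L' 0 T p HT Hp) as F.
    apply (Sat s rho); [auto|apply F|].
    eapply (evs_of_mem L' kk ee TT Hm 0 rho 0); eauto.
    rewrite E0. apply S1. apply (mem_rimg L' 0 T _ HT). exists p. auto.
  - intros s. destruct (Vals s) as [rho Es].
    (* Formulas of [P] see only the first [n] values of [s], so one stage names all that matters.
       Its model refutes some formula there, and completeness carries the negation to the limit. *)
    destruct (bound_stage kk ee TT Hm Hg rho n) as [t R].
    destruct (ev_model L L' M X _ _ kk ee TT Hst t) as (B & N & HB & HN & HO).
    destruct (HO (fun i => cN N (rho i))) as (q & Hq & K).
    apply (mem_rimg L' n P q HP) in Hq as (p & Hp & ->).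
    pose proof (type_in_mem L' n P p HP Hp) as F.
    exists p. split; auto. intros Hsat. apply (Sat s rho) in Hsat; [|auto|apply F].
    eapply evs_not; [exact Hst|exact Hsat|].
    eapply (evs_of_mem L' kk ee TT Hm t rho n (Neg p)); eauto.
    eapply (mem_of_sat L L' M X _ _ kk ee TT Hst t rho n (Neg p)); eauto.
    cbn [sat]. now rewrite <- sat_rn.
Qed.

End Expansion.

Theorem mainTheorem2 (L : lang) (A : Type) (M : structure A) :
  recursive_lang L -> inhabited A -> countable A ->
  Con_sat_saturated L M -> transcendent L M.
Proof.
  intros HL HA Hc (X & HX & HM). split.
  - eapply X_saturated_strongly_homogeneous; eauto. apply HX.
  - exists X. split; [apply HX|split; [exact HM|]].
    intros L' T n P HL' HLL' HT XT HP XP HC. eapply Con_sat_expansion; eauto.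
Qed.
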